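(* Over $\mathrm{RCA}_0$, Martin's pointed tree theorem $\mathrm{MPT}$ does not imply $\mathrm{WKL}_0$; that is, $\mathrm{RCA}_0 + \mathrm{MPT} \not\vdash \mathrm{WKL}_0$.
   Context: All theories are in the language of second order arithmetic, with models $(N,M,0,1,+,\times,<)$, where $N$ is the number sort and $M$ is the sort of sets of numbers (equivalently, up to coding, functions from numbers to numbers, called reals). $\mathrm{RCA}_0$ is the usual base system of reverse mathematics. $\mathrm{WKL}_0$ is $\mathrm{RCA}_0$ plus the statement that every infinite binary tree has an infinite path. $\leq_{\rm T}$ denotes Turing reducibility. A tree $T\subseteq\omega^{<\omega}$ is a set of finite strings closed under initial segments; $[T]$ is the collection of its infinite paths. A perfect tree is a nonempty tree in which every node has two incompatible extensions in the tree. A set $A$ of reals is cofinal if for every real $x$ there is some $y\in A$ with $y\geq_{\rm T} x$. A pointed tree $T$ is a perfect tree such that $T\leq_{\rm T} x$ for every infinite path $x\in[T]$. Martin's pointed tree theorem, $\mathrm{MPT}$, is the statement (formulated in second order arithmetic): for every tree $T\subseteq\omega^{<\omega}$, if $[T]$ is cofinal, then $T$ has a pointed subtree. *)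

(* Defs.v *)
From Stdlib Require Import List.
Import ListNotations.

(** * Second order arithmetic: syntax

    De Bruijn indices, with independent index spaces for number variables and
    set variables.  Equality is primitive for numbers only; the remaining
    connectives and the existential quantifiers are the classical
    abbreviations. *)

Inductive term : Type :=
| tvar (n : nat)
| tzero
| tone
| tplus (t u : term)
| ttimes (t u : term).

Inductive form : Type :=
| fEq (t u : term)
| fLt (t u : term)
| fIn (t : term) (X : nat)
| fBot
| fImp (p q : form)
| fAllN (p : form)
| fAllS (p : form).

Definition fNot (p : form) : form := fImp p fBot.
Definition fAnd (p q : form) : form := fNot (fImp p (fNot q)).
Definition fOr (p q : form) : form := fImp (fNot p) q.
Definition fIff (p q : form) : form := fAnd (fImp p q) (fImp q p).
Definition fExN (p : form) : form := fNot (fAllN (fNot p)).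
Definition fExS (p : form) : form := fNot (fAllS (fNot p)).

Definition scons {A : Type} (a : A) (f : nat -> A) (n : nat) : A :=
  match n with O => a | S n => f n end.

Fixpoint substT (s : nat -> term) (t : term) : term :=
  match t with
  | tvar n => s n
  | tzero => tzero
  | tone => tone
  | tplus t u => tplus (substT s t) (substT s u)
  | ttimes t u => ttimes (substT s t) (substT s u)
  end.

Definition shiftT : term -> term := substT (fun n => tvar (S n)).

(* [s] acts on number variables and [r] on set variables; set variables are
   the only set terms. *)
Fixpoint subst (s : nat -> term) (r : nat -> nat) (p : form) : form :=
  match p with
  | fEq t u => fEq (substT s t) (substT s u)
  | fLt t u => fLt (substT s t) (substT s u)
  | fIn t X => fIn (substT s t) (r X)
  | fBot => fBot
  | fImp p q => fImp (subst s r p) (subst s r q)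
  | fAllN p => fAllN (subst (scons (tvar 0) (fun n => shiftT (s n))) r p)
  | fAllS p => fAllS (subst s (scons 0 (fun n => S (r n))) p)
  end.

Definition shiftN : form -> form := subst (fun n => tvar (S n)) (fun X => X).
Definition shiftS : form -> form := subst tvar S.
Definition instN (t : term) : form -> form := subst (scons t tvar) (fun X => X).
Definition instS (X : nat) : form -> form := subst tvar (scons X (fun Y => Y)).

(** * Provability

    Classical two-sorted natural deduction.  An axiom of [T] may have free
    variables and stands for its universal closure: it is available under
    every context of hypotheses, so its variables can be generalized. *)

Definition theory : Type := form -> Prop.

Inductive prv (T : theory) : list form -> form -> Prop :=
| prv_ax G p : T p -> prv T G p
| prv_hyp G p : In p G -> prv T G p
| prv_impI G p q : prv T (p :: G) q -> prv T G (fImp p q)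
| prv_impE G p q : prv T G (fImp p q) -> prv T G p -> prv T G q
| prv_raa G p : prv T (fNot p :: G) fBot -> prv T G p
| prv_allNI G p : prv T (map shiftN G) p -> prv T G (fAllN p)
| prv_allNE G p t : prv T G (fAllN p) -> prv T G (instN t p)
| prv_allSI G p : prv T (map shiftS G) p -> prv T G (fAllS p)
| prv_allSE G p X : prv T G (fAllS p) -> prv T G (instS X p)
| prv_refl G t : prv T G (fEq t t)
| prv_leibniz G p t u :
    prv T G (fEq t u) -> prv T G (instN t p) -> prv T G (instN u p).

Definition proves (T : theory) (p : form) : Prop := prv T [] p.
Definition implies_theory (T U : theory) : Prop := forall p, U p -> proves T p.
Definition extend (T : theory) (a : form) : theory := fun p => T p \/ p = a.

(** * Writing formulas with Rocq binders

    [Tm], [Sv] and [Fm] are terms, set variables and formulas depending on the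
    number of enclosing number quantifiers [d] and set quantifiers [s].  A
    variable bound at depth [d] has index [d' - S d] when used at depth [d'];
    a closed formula [P : Fm] denotes [P 0 0]. *)

Definition Tm : Type := nat -> term.
Definition Sv : Type := nat -> nat.
Definition Fm : Type := nat -> nat -> form.

Definition ALLN (P : Tm -> Fm) : Fm :=
  fun d s => fAllN (P (fun d' => tvar (d' - S d)) (S d) s).
Definition EXN (P : Tm -> Fm) : Fm :=
  fun d s => fExN (P (fun d' => tvar (d' - S d)) (S d) s).
Definition ALLS (P : Sv -> Fm) : Fm :=
  fun d s => fAllS (P (fun s' => s' - S s) d (S s)).
Definition EXS (P : Sv -> Fm) : Fm :=
  fun d s => fExS (P (fun s' => s' - S s) d (S s)).

Definition TZero : Tm := fun _ => tzero.
Definition TOne : Tm := fun _ => tone.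
Definition TPlus (t u : Tm) : Tm := fun d => tplus (t d) (u d).
Definition TTimes (t u : Tm) : Tm := fun d => ttimes (t d) (u d).
Definition FEq (t u : Tm) : Fm := fun d _ => fEq (t d) (u d).
Definition FLt (t u : Tm) : Fm := fun d _ => fLt (t d) (u d).
Definition FIn (t : Tm) (X : Sv) : Fm := fun d s => fIn (t d) (X s).
Definition FNot (P : Fm) : Fm := fun d s => fNot (P d s).
Definition FImp (P Q : Fm) : Fm := fun d s => fImp (P d s) (Q d s).
Definition FAnd (P Q : Fm) : Fm := fun d s => fAnd (P d s) (Q d s).
Definition FOr (P Q : Fm) : Fm := fun d s => fOr (P d s) (Q d s).
Definition FIff (P Q : Fm) : Fm := fun d s => fIff (P d s) (Q d s).

Declare Scope l2_scope.
Delimit Scope l2_scope with l2.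
Notation "'ALL' x .. y , P" := (ALLN (fun x => .. (ALLN (fun y => P)) ..))
  (at level 200, x binder, y binder, right associativity) : l2_scope.
Notation "'EX' x .. y , P" := (EXN (fun x => .. (EXN (fun y => P)) ..))
  (at level 200, x binder, y binder, right associativity) : l2_scope.
Notation "'ALLSET' X .. Y , P" := (ALLS (fun X => .. (ALLS (fun Y => P)) ..))
  (at level 200, X binder, Y binder, right associativity) : l2_scope.
Notation "'EXSET' X .. Y , P" := (EXS (fun X => .. (EXS (fun Y => P)) ..))
  (at level 200, X binder, Y binder, right associativity) : l2_scope.
Notation "0" := TZero : l2_scope.
Notation "1" := TOne : l2_scope.
Notation "t + u" := (TPlus t u) : l2_scope.
Notation "t * u" := (TTimes t u) : l2_scope.
Notation "t = u" := (FEq t u) : l2_scope.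
Notation "t < u" := (FLt t u) : l2_scope.
Notation "t ∈ X" := (FIn t X) (at level 70, no associativity) : l2_scope.
Notation "~ P" := (FNot P) : l2_scope.
Notation "P /\ Q" := (FAnd P Q) : l2_scope.
Notation "P \/ Q" := (FOr P Q) : l2_scope.
Notation "P -> Q" := (FImp P Q) : l2_scope.
Notation "P <-> Q" := (FIff P Q) : l2_scope.
Local Open Scope l2_scope.

Fixpoint num (n : nat) : Tm :=
  match n with O => TZero | S n => TPlus (num n) TOne end.

(** * The theory RCA_0 *)

Definition basic_axioms : list Fm :=
  [ ALL n, ~ (n + 1 = 0);
    ALL m n, m + 1 = n + 1 -> m = n;
    ALL m, m + 0 = m;
    ALL m n, m + (n + 1) = (m + n) + 1;
    ALL m, m * 0 = 0;
    ALL m n, m * (n + 1) = m * n + m;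
    ALL m, ~ (m < 0);
    ALL m n, m < n + 1 <-> (m < n \/ m = n) ].

(* Formulas with bounded number quantifiers only.  A bounded existential
   quantifier is expressed as [not (forall n < t) not]. *)
Inductive Delta0 : form -> Prop :=
| Delta0_eq t u : Delta0 (fEq t u)
| Delta0_lt t u : Delta0 (fLt t u)
| Delta0_in t X : Delta0 (fIn t X)
| Delta0_bot : Delta0 fBot
| Delta0_imp p q : Delta0 p -> Delta0 q -> Delta0 (fImp p q)
| Delta0_ball t p :
    Delta0 p -> Delta0 (fAllN (fImp (fLt (tvar 0) (shiftT t)) p)).

Inductive Sigma1 : form -> Prop := Sigma1_ex p : Delta0 p -> Sigma1 (fExN p).
Inductive Pi1 : form -> Prop := Pi1_all p : Delta0 p -> Pi1 (fAllN p).

(* The distinguished number variable of [p] and [q] is number variable 0; all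
   other variables are parameters. *)
Definition induction_for (p : form) : form :=
  fImp
    (fAnd (instN tzero p)
       (fAllN (fImp p
          (subst (scons (tplus (tvar 0) tone) (fun n => tvar (S n))) (fun X => X) p))))
    (fAllN p).

Definition comprehension_for (p q : form) : form :=
  fImp (fAllN (fIff p q)) (fExS (fAllN (fIff (fIn (tvar 0) 0) (shiftS p)))).

Inductive RCA0 : theory :=
| RCA0_basic P : In P basic_axioms -> RCA0 (P 0%nat 0%nat)
| RCA0_induction p : Sigma1 p -> RCA0 (induction_for p)
| RCA0_comprehension p q : Sigma1 p -> Pi1 q -> RCA0 (comprehension_for p q).

(** * Coding of pairs, finite sets and finite sequences

    As in Simpson, Subsystems of Second Order Arithmetic, II.2:
    [(i, j)] is [(i + j)^2 + i]; the number [((k, m), n)] codes the set of all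
    [i < k] such that [m (i + 1) + 1] divides [n]; the code of a finite set is
    the least number coding it, so that it is unique. *)

Definition Pair (i j : Tm) : Tm := (i + j) * (i + j) + i.

Definition Form_setcode (c : Tm) : Fm := EX k m n, c = Pair (Pair k m) n.

Definition El (x c : Tm) : Fm :=
  EX k m n, c = Pair (Pair k m) n /\ x < k /\ (EX q, n = q * (m * (x + 1) + 1)).

Definition Finset (c : Tm) : Fm :=
  Form_setcode c /\
  (ALL b, b < c /\ Form_setcode b -> ~ (ALL x, El x b <-> El x c)).

Definition Entry (s i v : Tm) : Fm := El (Pair i v) s.

Definition Seq (s : Tm) : Fm :=
  Finset s /\
  (ALL x, El x s -> EX i v, x = Pair i v) /\
  (ALL i v w, Entry s i v /\ Entry s i w -> v = w) /\
  (EX l, ALL i, i < l <-> EX v, Entry s i v).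

(* [s] is an initial segment of [t], for sequences [s] and [t]. *)
Definition Initial (s t : Tm) : Fm := ALL i v, Entry s i v -> Entry t i v.

Definition Incompatible (s t : Tm) : Fm :=
  EX i v w, Entry s i v /\ Entry t i w /\ ~ (v = w).

(** * Turing reducibility

    Partial functions computable relative to [Y] are generated, following
    Shoenfield, from constants, projections, the characteristic function of
    [Y], [+], [*] and the characteristic function of [<] by pairing,
    composition and minimization; functions of several arguments are functions
    of a coded pair.  An index [(tag, (a, b))] records the last clause used and
    the indices [a], [b] of its ingredients.

    A computation is a finite set of facts [(e, (x, y))], to be read "the
    function with index [e] has value [y] at [x]", each of which is justified
    by others.  Justifications only appeal to smaller indices, so they are
    well-founded. *)

Definition index (tag : nat) (a b : Tm) : Tm := Pair (num tag) (Pair a b).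

Definition Fact (D e x y : Tm) : Fm := El (Pair e (Pair x y)) D.

Definition Justified (D : Tm) (Y : Sv) (e x y : Tm) : Fm :=
  (* constant [a] *)
  (EX a, e = index 0 a 0 /\ y = a) \/
  (* identity *)
  (e = index 1 0 0 /\ y = x) \/
  (* projections *)
  (e = index 2 0 0 /\ EX v, x = Pair y v) \/
  (e = index 3 0 0 /\ EX u, x = Pair u y) \/
  (* oracle *)
  (e = index 4 0 0 /\ ((x ∈ Y /\ y = 1) \/ (~ (x ∈ Y) /\ y = 0))) \/
  (* addition, multiplication, order *)
  (e = index 5 0 0 /\ EX u v, x = Pair u v /\ y = u + v) \/
  (e = index 6 0 0 /\ EX u v, x = Pair u v /\ y = u * v) \/
  (e = index 7 0 0 /\
    EX u v, x = Pair u v /\ ((u < v /\ y = 1) \/ (~ (u < v) /\ y = 0))) \/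
  (* pairing of two functions *)
  (EX a b, e = index 8 a b /\
    EX u v, Fact D a x u /\ Fact D b x v /\ y = Pair u v) \/
  (* composition *)
  (EX a b, e = index 9 a b /\ EX u, Fact D b x u /\ Fact D a u y) \/
  (* minimization: [y] is least with value 0 at [(x, y)] *)
  (EX a, e = index 10 a 0 /\ Fact D a (Pair x y) 0 /\
    (ALL z, z < y -> EX w, Fact D a (Pair x z) (w + 1))).

Definition Computation (D : Tm) (Y : Sv) : Fm :=
  ALL e x y, Fact D e x y -> Justified D Y e x y.

Definition Value (Y : Sv) (e x y : Tm) : Fm :=
  EX D, Computation D Y /\ Fact D e x y.

Definition Turing_le (X Y : Sv) : Fm :=
  EX e, ALL n, (n ∈ X /\ Value Y e n 1) \/ (~ (n ∈ X) /\ Value Y e n 0).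

(** * Trees, paths, MPT and WKL_0 *)

Definition IsFunction (X : Sv) : Fm :=
  (ALL x, x ∈ X -> EX i v, x = Pair i v) /\
  (ALL i, EX v, Pair i v ∈ X) /\
  (ALL i v w, Pair i v ∈ X /\ Pair i w ∈ X -> v = w).

Definition Tree (T : Sv) : Fm :=
  (ALL t, t ∈ T -> Seq t) /\
  (ALL s t, t ∈ T /\ Seq s /\ Initial s t -> s ∈ T).

Definition Path (X T : Sv) : Fm :=
  IsFunction X /\
  (ALL s, Seq s /\ (ALL i v, Entry s i v -> Pair i v ∈ X) -> s ∈ T).

Definition Subset (S T : Sv) : Fm := ALL n, n ∈ S -> n ∈ T.

Definition Perfect (T : Sv) : Fm :=
  Tree T /\ (EX s, s ∈ T) /\
  (ALL s, s ∈ T -> EX t u,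
    t ∈ T /\ u ∈ T /\ Initial s t /\ Initial s u /\ Incompatible t u).

Definition Pointed (T : Sv) : Fm :=
  Perfect T /\ (ALLSET X, Path X T -> Turing_le T X).

Definition Cofinal_paths (T : Sv) : Fm :=
  ALLSET X, EXSET Y, Path Y T /\ Turing_le X Y.

Definition MPT_formula : Fm :=
  ALLSET T, Tree T /\ Cofinal_paths T -> EXSET S, Subset S T /\ Pointed S.

Definition Binary (T : Sv) : Fm :=
  ALL s i v, s ∈ T /\ Entry s i v -> v < num 2.

Definition Infinite (X : Sv) : Fm := ~ (EX k, ALL n, n ∈ X -> n < k).

Definition WKL_formula : Fm :=
  ALLSET T, Tree T /\ Binary T /\ Infinite T -> EXSET X, Path X T.

Definition MPT : form := MPT_formula 0%nat 0%nat.
Definition WKL : form := WKL_formula 0%nat 0%nat.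

Definition WKL0 : theory := extend RCA0 WKL.

(* Main.v *)
(* An omega-model separates the two statements.  Let [Y_0] be empty and
   [Y_(n+1) = Y_n + G_n], with [G_n] a Cohen generic real over [Y_n]; the sets of
   the model are those computable from some [Y_n].

   The key step concerns a tree [T] computable from [Y] with a path [X] computable
   from [Y + G], where [G] is generic over [Y], such that [psi^X = Z] for some [Z]
   computable from [Y].  A condition in [G] forces all this.  Either it has no
   extensions forcing incompatible values of [X], and then [X] is computable from
   [Y]; or [Y] computes a perfect tree of conditions with splitting values,
   hence a perfect subtree [S] of [T], each path [X'] of which is built from
   conditions deciding more and more of [psi^X'], so that [psi^X' = Z].
   In both cases [T] has a path computable from [Y].

   If the paths of [T], computable from [Y_n], are cofinal in the model, then some path
   computes [Y_(n+1)].  The key step, iterated, brings this path down to [Y_(n+1)];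
   applied once more with [Z = Y_n], its first alternative would make [Y_(n+1)]
   computable from [Y_n], so the second gives a subtree computable from [Y_n] all of
   whose paths compute [Y_n].  On the other hand a computable tree with
   a path in the model has a computable path, which refutes WKL. *)

From Stdlib Require Import Arith Lia List Factorial.
From Stdlib Require Import Classical ClassicalEpsilon FunctionalExtensionality PropExtensionality.
Require Import Defs.
Import ListNotations.

(** * Henkin semantics over the standard natural numbers *)

(** The model must have no largest degree: if some set [X] computed all the others, a tree whose
    only path codes [X] would have cofinal paths and no perfect subtree, so already the computable
    sets alone violate MPT. This is why the generic extension is iterated, and why cofinality can be
    tested at the stage above the one that computes the tree: the path found there escapes the lower
    stage.

    A descent replaces the path by another one, which has to compute the same [Z]. The key step
    therefore carries the reduction [psi] along and returns it unchanged.

    Genericity over [Y] means to meet or to avoid countably many sets of conditions, one for each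
    choice of programs. These sets may be complicated; what has to be computable in [Y] is the
    perfect tree below one good condition. Relations are hence shown semi-decidable from the shape
    of their definitions ([Ar]), and programs appear where an index is needed: for names of sets,
    for the countability of the requirements and for diagonalization. *)

Fixpoint evalT (v : nat -> nat) (t : term) : nat :=
  match t with
  | tvar n => v n
  | tzero => 0
  | tone => 1
  | tplus t u => evalT v t + evalT v u
  | ttimes t u => evalT v t * evalT v u
  end.

Fixpoint sat (M : (nat -> Prop) -> Prop) (v : nat -> nat) (V : nat -> nat -> Prop)
    (p : form) : Prop :=
  match p with
  | fEq t u => evalT v t = evalT v u
  | fLt t u => evalT v t < evalT v u
  | fIn t X => V X (evalT v t)
  | fBot => False
  | fImp p q => sat M v V p -> sat M v V q
  | fAllN p => forall a, sat M (scons a v) V p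
  | fAllS p => forall A, M A -> sat M v (scons A V) p
  end.

Lemma evalT_subst s v t : evalT v (substT s t) = evalT (fun n => evalT v (s n)) t.
Proof. induction t; simpl; congruence. Qed.

Lemma scons_comp {A B : Type} (g : A -> B) a f :
  (fun n => g (scons a f n)) = scons (g a) (fun n => g (f n)).
Proof. apply functional_extensionality; intros [|n]; reflexivity. Qed.

Lemma sat_subst M p : forall s r v V,
  sat M v V (subst s r p) <-> sat M (fun n => evalT v (s n)) (fun X => V (r X)) p.
Proof.
  induction p; intros s r v V; simpl; rewrite ?evalT_subst; try tauto.
  - rewrite IHp1, IHp2. tauto.
  - assert (E : forall a, (fun n => evalT (scons a v) (scons (tvar 0) (fun n => shiftT (s n)) n))
                 = scons a (fun n => evalT v (s n))).
    { intros a. apply functional_extensionality; intros [|n]; [reflexivity|].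
      simpl. unfold shiftT. rewrite evalT_subst. reflexivity. }
    split; intros H a; specialize (H a); rewrite IHp, E in *; exact H.
  - assert (E : forall A, (fun X => scons A V (scons 0 (fun n => S (r n)) X))
                 = scons A (fun X => V (r X))).
    { intros A. apply functional_extensionality; intros [|n]; reflexivity. }
    split; intros H A HA; specialize (H A HA); rewrite IHp, E in *; exact H.
Qed.

Lemma sat_shiftN M a v V p : sat M (scons a v) V (shiftN p) <-> sat M v V p.
Proof. unfold shiftN. rewrite sat_subst. reflexivity. Qed.

Lemma sat_shiftS M A v V p : sat M v (scons A V) (shiftS p) <-> sat M v V p.
Proof. unfold shiftS. rewrite sat_subst. reflexivity. Qed.

Lemma sat_instN M v V t p : sat M v V (instN t p) <-> sat M (scons (evalT v t) v) V p.
Proof. unfold instN. rewrite sat_subst, scons_comp. reflexivity. Qed.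

Lemma sat_instS M v V X p : sat M v V (instS X p) <-> sat M v (scons (V X) V) p.
Proof. unfold instS. rewrite sat_subst, scons_comp. reflexivity. Qed.

(** All assignments are quantified because an axiom with free variables stands for its universal
    closure. *)
Definition models (M : (nat -> Prop) -> Prop) (p : form) : Prop :=
  forall v V, (forall X, M (V X)) -> sat M v V p.

Lemma soundness M T : (forall p, T p -> models M p) ->
  forall G p, prv T G p -> forall v V, (forall X, M (V X)) ->
  (forall q, In q G -> sat M v V q) -> sat M v V p.
Proof.
  intros HT G p H.
  induction H; intros v V HV HG.
  - apply HT; assumption.
  - apply HG; assumption.
  - intros Hp. apply IHprv; [assumption|].
    intros r [->|Hr]; [assumption|auto].
  - apply (IHprv1 v V HV HG), (IHprv2 v V HV HG).
  - apply NNPP. intros Hn. apply (IHprv v V HV).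
    intros r [<-|Hr]; [exact Hn|auto].
  - intros a. apply IHprv; [assumption|].
    intros r Hr. apply in_map_iff in Hr as (r' & <- & Hr').
    apply sat_shiftN. auto.
  - apply sat_instN. apply (IHprv v V HV HG).
  - intros A HA. apply IHprv.
    + intros [|X]; [exact HA|apply HV].
    + intros r Hr. apply in_map_iff in Hr as (r' & <- & Hr').
      apply sat_shiftS. auto.
  - apply sat_instS. apply (IHprv v V HV HG). apply HV.
  - reflexivity.
  - apply sat_instN. rewrite <- (IHprv1 v V HV HG : evalT v t = evalT v u).
    apply sat_instN. apply (IHprv2 v V HV HG).
Qed.

Lemma models_proves M T p X : M X -> (forall q, T q -> models M q) ->
  proves T p -> sat M (fun _ => 0) (fun _ => X) p.
Proof.
  intros HX HT H. apply (soundness M T HT _ _ H); [auto|intros q []].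
Qed.

(** * Reading formulas written with binders *)

Fixpoint consl {A : Type} (l : list A) (f : nat -> A) : nat -> A :=
  match l with [] => f | a :: l => scons a (consl l f) end.

(* [x] keeps the value [a] at depth [d] and at every greater depth, whatever
   the values of the intermediate bound variables. *)
Definition TmV (x : Tm) (d : nat) (v : nat -> nat) (a : nat) : Prop :=
  forall l, evalT (consl l v) (x (length l + d)) = a.

Definition SvV (X : Sv) (s : nat) (V : nat -> nat -> Prop) (A : nat -> Prop) : Prop :=
  forall l, consl l V (X (length l + s)) = A.

(** [Q] is a Rocq proposition of the same shape as [P]. The lemmas about [Rep] follow that shape, so
    translating a formula becomes a syntax-directed search. *)
Definition Rep (M : (nat -> Prop) -> Prop) (P : Fm) d s v V (Q : Prop) : Prop :=
  sat M v V (P d s) <-> Q.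

Lemma consl_app {A} (l : list A) a f : consl (l ++ [a]) f = consl l (scons a f).
Proof. induction l as [|b l IH]; simpl; [reflexivity|now rewrite IH]. Qed.

Lemma consl_length {A} (l : list A) f n : consl l f (length l + n) = f n.
Proof. induction l; simpl; auto. Qed.

Lemma TmV_0 x d v a : TmV x d v a -> evalT v (x d) = a.
Proof. intros H. exact (H []). Qed.

Lemma SvV_0 X s V A : SvV X s V A -> V (X s) = A.
Proof. intros H. exact (H []). Qed.

Lemma TmV_scons x d v a b : TmV x d v a -> TmV x (S d) (scons b v) a.
Proof.
  intros H l. rewrite <- consl_app.
  replace (length l + S d) with (length (l ++ [b]) + d); [apply H|].
  rewrite length_app. simpl. lia.
Qed.

Lemma SvV_scons X s V A B : SvV X s V A -> SvV X (S s) (scons B V) A.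
Proof.
  intros H l. rewrite <- consl_app.
  replace (length l + S s) with (length (l ++ [B]) + s); [apply H|].
  rewrite length_app. simpl. lia.
Qed.

Lemma TmV_var d v a : TmV (fun d' => tvar (d' - S d)) (S d) (scons a v) a.
Proof.
  intros l. simpl. replace (length l + S d - S d) with (length l + 0) by lia.
  rewrite consl_length. reflexivity.
Qed.

Lemma SvV_var s V A : SvV (fun s' => s' - S s) (S s) (scons A V) A.
Proof.
  intros l. simpl. replace (length l + S s - S s) with (length l + 0) by lia.
  rewrite consl_length. reflexivity.
Qed.

Lemma TmV_zero d v : TmV TZero d v 0.
Proof. intros l; reflexivity. Qed.
Lemma TmV_one d v : TmV TOne d v 1.
Proof. intros l; reflexivity. Qed.
Lemma TmV_plus x y d v a b : TmV x d v a -> TmV y d v b -> TmV (TPlus x y) d v (a + b).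
Proof. intros Hx Hy l; simpl. now rewrite Hx, Hy. Qed.
Lemma TmV_times x y d v a b : TmV x d v a -> TmV y d v b -> TmV (TTimes x y) d v (a * b).
Proof. intros Hx Hy l; simpl. now rewrite Hx, Hy. Qed.
Lemma TmV_num d v n : TmV (num n) d v n.
Proof.
  induction n; simpl; [apply TmV_zero|].
  replace (S n) with (n + 1) by lia. apply TmV_plus; [assumption|apply TmV_one].
Qed.

Section Rep.
Variable M : (nat -> Prop) -> Prop.

Lemma Rep_eq x y d s v V a b : TmV x d v a -> TmV y d v b ->
  Rep M (FEq x y) d s v V (a = b).
Proof.
  intros Hx Hy. apply TmV_0 in Hx, Hy. unfold Rep. simpl. now rewrite Hx, Hy.
Qed.

Lemma Rep_lt x y d s v V a b : TmV x d v a -> TmV y d v b ->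
  Rep M (FLt x y) d s v V (a < b).
Proof.
  intros Hx Hy. apply TmV_0 in Hx, Hy. unfold Rep. simpl. now rewrite Hx, Hy.
Qed.

Lemma Rep_in x X d s v V a A : TmV x d v a -> SvV X s V A ->
  Rep M (FIn x X) d s v V (A a).
Proof.
  intros Hx HX. apply TmV_0 in Hx. apply SvV_0 in HX. unfold Rep. simpl. now rewrite Hx, HX.
Qed.

Lemma Rep_not P d s v V Q : Rep M P d s v V Q -> Rep M (FNot P) d s v V (~ Q).
Proof. unfold Rep. simpl. tauto. Qed.

Lemma Rep_imp P P' d s v V Q Q' : Rep M P d s v V Q -> Rep M P' d s v V Q' ->
  Rep M (FImp P P') d s v V (Q -> Q').
Proof. unfold Rep. simpl. tauto. Qed.

Lemma Rep_and P P' d s v V Q Q' : Rep M P d s v V Q -> Rep M P' d s v V Q' ->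
  Rep M (FAnd P P') d s v V (Q /\ Q').
Proof. unfold Rep. simpl. tauto. Qed.

Lemma Rep_or P P' d s v V Q Q' : Rep M P d s v V Q -> Rep M P' d s v V Q' ->
  Rep M (FOr P P') d s v V (Q \/ Q').
Proof. unfold Rep. simpl. tauto. Qed.

Lemma Rep_iff P P' d s v V Q Q' : Rep M P d s v V Q -> Rep M P' d s v V Q' ->
  Rep M (FIff P P') d s v V (Q <-> Q').
Proof. unfold Rep. simpl. tauto. Qed.

Lemma Rep_all P d s v V (Q : nat -> Prop) :
  (forall x a, TmV x (S d) (scons a v) a -> Rep M (P x) (S d) s (scons a v) V (Q a)) ->
  Rep M (ALLN P) d s v V (forall a, Q a).
Proof.
  intros H. split; intros K a; apply (H _ a (TmV_var d v a)); apply K.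
Qed.

Lemma Rep_ex P d s v V (Q : nat -> Prop) :
  (forall x a, TmV x (S d) (scons a v) a -> Rep M (P x) (S d) s (scons a v) V (Q a)) ->
  Rep M (EXN P) d s v V (exists a, Q a).
Proof.
  intros H. split; simpl.
  - intros K. apply NNPP. intros N. apply K. intros a Ha. apply N.
    exists a. apply (H _ a (TmV_var d v a)), Ha.
  - intros (a & Ha) K. apply (K a). apply (H _ a (TmV_var d v a)), Ha.
Qed.

Lemma Rep_allS P d s v V (Q : (nat -> Prop) -> Prop) :
  (forall X A, SvV X (S s) (scons A V) A -> Rep M (P X) d (S s) v (scons A V) (Q A)) ->
  Rep M (ALLS P) d s v V (forall A, M A -> Q A).
Proof.
  intros H. split; intros K A HA; apply (H _ A (SvV_var s V A)); apply K, HA.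
Qed.

Lemma Rep_exS P d s v V (Q : (nat -> Prop) -> Prop) :
  (forall X A, SvV X (S s) (scons A V) A -> Rep M (P X) d (S s) v (scons A V) (Q A)) ->
  Rep M (EXS P) d s v V (exists A, M A /\ Q A).
Proof.
  intros H. split; simpl.
  - intros K. apply NNPP. intros N. apply K. intros A HA Ha. apply N.
    exists A. split; [exact HA|]. apply (H _ A (SvV_var s V A)), Ha.
  - intros (A & HA & Ha) K. apply (K A HA). apply (H _ A (SvV_var s V A)), Ha.
Qed.

End Rep.

(** * Semantics of the coding predicates *)

Definition cpair (i j : nat) : nat := (i + j) * (i + j) + i.
Definition setcode (c : nat) : Prop := exists k m n, c = cpair (cpair k m) n.
Definition el (x c : nat) : Prop :=
  exists k m n, c = cpair (cpair k m) n /\ x < k /\ exists q, n = q * (m * (x + 1) + 1).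
Definition finset (c : nat) : Prop :=
  setcode c /\ forall b, b < c /\ setcode b -> ~ (forall x, el x b <-> el x c).
Definition entry (s i v : nat) : Prop := el (cpair i v) s.
Definition isseq (s : nat) : Prop :=
  finset s /\
  (forall x, el x s -> exists i v, x = cpair i v) /\
  (forall i v w, entry s i v /\ entry s i w -> v = w) /\
  (exists l, forall i, i < l <-> exists v, entry s i v).
Definition initial (s t : nat) : Prop := forall i v, entry s i v -> entry t i v.
Definition incompat (s t : nat) : Prop :=
  exists i v w, entry s i v /\ entry t i w /\ ~ v = w.
Definition ix (tag a b : nat) : nat := cpair tag (cpair a b).
Definition fact (D e x y : nat) : Prop := el (cpair e (cpair x y)) D.

(* The set of facts [F] is a parameter, so that computations can be assembled
   from lists before they are coded. *)
Definition justified (F : nat -> nat -> nat -> Prop) (Y : nat -> Prop) (e x y : nat) : Prop :=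
  (exists a, e = ix 0 a 0 /\ y = a) \/
  (e = ix 1 0 0 /\ y = x) \/
  (e = ix 2 0 0 /\ exists v, x = cpair y v) \/
  (e = ix 3 0 0 /\ exists u, x = cpair u y) \/
  (e = ix 4 0 0 /\ ((Y x /\ y = 1) \/ (~ Y x /\ y = 0))) \/
  (e = ix 5 0 0 /\ exists u v, x = cpair u v /\ y = u + v) \/
  (e = ix 6 0 0 /\ exists u v, x = cpair u v /\ y = u * v) \/
  (e = ix 7 0 0 /\
    exists u v, x = cpair u v /\ ((u < v /\ y = 1) \/ (~ (u < v) /\ y = 0))) \/
  (exists a b, e = ix 8 a b /\ exists u v, F a x u /\ F b x v /\ y = cpair u v) \/
  (exists a b, e = ix 9 a b /\ exists u, F b x u /\ F a u y) \/
  (exists a, e = ix 10 a 0 /\ F a (cpair x y) 0 /\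
    (forall z, z < y -> exists w, F a (cpair x z) (w + 1))).
Definition computation (D : nat) (Y : nat -> Prop) : Prop :=
  forall e x y, fact D e x y -> justified (fact D) Y e x y.
Definition value (Y : nat -> Prop) (e x y : nat) : Prop :=
  exists D, computation D Y /\ fact D e x y.
Definition turing_le (X Y : nat -> Prop) : Prop :=
  exists e, forall n, (X n /\ value Y e n 1) \/ (~ X n /\ value Y e n 0).
Definition isfun (X : nat -> Prop) : Prop :=
  (forall x, X x -> exists i v, x = cpair i v) /\
  (forall i, exists v, X (cpair i v)) /\
  (forall i v w, X (cpair i v) /\ X (cpair i w) -> v = w).
Definition tree (T : nat -> Prop) : Prop :=
  (forall t, T t -> isseq t) /\
  (forall s t, T t /\ isseq s /\ initial s t -> T s).
Definition path (X T : nat -> Prop) : Prop :=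
  isfun X /\ (forall s, isseq s /\ (forall i v, entry s i v -> X (cpair i v)) -> T s).
Definition perfect (T : nat -> Prop) : Prop :=
  tree T /\ (exists s, T s) /\
  (forall s, T s -> exists t u, T t /\ T u /\ initial s t /\ initial s u /\ incompat t u).

Lemma TmV_pair x y d v a b : TmV x d v a -> TmV y d v b -> TmV (Pair x y) d v (cpair a b).
Proof. intros. unfold Pair, cpair. repeat (assumption || apply TmV_plus || apply TmV_times). Qed.

Lemma TmV_index n x y d v a b : TmV x d v a -> TmV y d v b ->
  TmV (index n x y) d v (ix n a b).
Proof. intros. unfold index, ix. repeat apply TmV_pair; [apply TmV_num|assumption..]. Qed.

Ltac rep_atom :=
  lazymatch goal with
  | |- TmV TZero _ _ _ => apply TmV_zero
  | |- TmV TOne _ _ _ => apply TmV_one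
  | |- TmV (num _) _ _ _ => apply TmV_num
  | |- TmV (TPlus _ _) _ _ _ => apply TmV_plus; rep_atom
  | |- TmV (TTimes _ _) _ _ _ => apply TmV_times; rep_atom
  | |- TmV (Pair _ _) _ _ _ => apply TmV_pair; rep_atom
  | |- TmV (index _ _ _) _ _ _ => apply TmV_index; rep_atom
  | H : TmV ?x ?d _ _ |- TmV ?x ?d _ _ => exact H
  | |- TmV _ (S _) _ _ => apply TmV_scons; rep_atom
  | H : SvV ?x ?d _ _ |- SvV ?x ?d _ _ => exact H
  | |- SvV _ (S _) _ _ => apply SvV_scons; rep_atom
  end.
Ltac rep_step :=
  lazymatch goal with
  | |- Rep _ (FAnd _ _) _ _ _ _ _ => apply Rep_and
  | |- Rep _ (FOr _ _) _ _ _ _ _ => apply Rep_or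
  | |- Rep _ (FNot _) _ _ _ _ _ => apply Rep_not
  | |- Rep _ (FImp _ _) _ _ _ _ _ => apply Rep_imp
  | |- Rep _ (FIff _ _) _ _ _ _ _ => apply Rep_iff
  | |- Rep _ (ALLN _) _ _ _ _ _ => apply Rep_all; intros ? ? ?
  | |- Rep _ (EXN _) _ _ _ _ _ => apply Rep_ex; intros ? ? ?
  | |- Rep _ (ALLS _) _ _ _ _ _ => apply Rep_allS; intros ? ? ?
  | |- Rep _ (EXS _) _ _ _ _ _ => apply Rep_exS; intros ? ? ?
  | |- Rep _ (FEq _ _) _ _ _ _ _ => apply Rep_eq; rep_atom
  | |- Rep _ (FLt _ _) _ _ _ _ _ => apply Rep_lt; rep_atom
  | |- Rep _ (FIn _ _) _ _ _ _ _ => apply Rep_in; rep_atom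
  end.
Ltac rep := repeat rep_step.

Ltac head_of t := lazymatch t with ?f _ => head_of f | _ => t end.
Ltac rep_use f lem :=
  lazymatch goal with
  | |- Rep _ ?P _ _ _ _ _ => let h := head_of P in constr_eq h f; apply lem; rep_atom
  end.

Section RepCoding.
Variable M : (nat -> Prop) -> Prop.

Lemma Rep_setcode c d s v V c' : TmV c d v c' ->
  Rep M (Form_setcode c) d s v V (setcode c').
Proof. intros. unfold Form_setcode, setcode. rep. Qed.

Lemma Rep_el x c d s v V x' c' : TmV x d v x' -> TmV c d v c' ->
  Rep M (El x c) d s v V (el x' c').
Proof. intros. unfold El, el. rep. Qed.

Lemma Rep_finset c d s v V c' : TmV c d v c' ->
  Rep M (Finset c) d s v V (finset c').
Proof.
  intros. unfold Finset, finset.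
  repeat first [ rep_step | rep_use Form_setcode Rep_setcode | rep_use El Rep_el ].
Qed.

Lemma Rep_entry c x y d s v V c' x' y' : TmV c d v c' -> TmV x d v x' -> TmV y d v y' ->
  Rep M (Entry c x y) d s v V (entry c' x' y').
Proof. intros. unfold Entry, entry. apply Rep_el; rep_atom. Qed.

Lemma Rep_seq c d s v V c' : TmV c d v c' -> Rep M (Seq c) d s v V (isseq c').
Proof.
  intros. unfold Seq, isseq.
  repeat first [ rep_step | rep_use Finset Rep_finset | rep_use Entry Rep_entry | rep_use El Rep_el ].
Qed.

Lemma Rep_initial x y d s v V x' y' : TmV x d v x' -> TmV y d v y' ->
  Rep M (Initial x y) d s v V (initial x' y').
Proof.
  intros. unfold Initial, initial.
  repeat first [ rep_step | rep_use Entry Rep_entry ].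
Qed.

Lemma Rep_incompat x y d s v V x' y' : TmV x d v x' -> TmV y d v y' ->
  Rep M (Incompatible x y) d s v V (incompat x' y').
Proof.
  intros. unfold Incompatible, incompat.
  repeat first [ rep_step | rep_use Entry Rep_entry ].
Qed.

Lemma Rep_fact D e x y d s v V D' e' x' y' :
  TmV D d v D' -> TmV e d v e' -> TmV x d v x' -> TmV y d v y' ->
  Rep M (Fact D e x y) d s v V (fact D' e' x' y').
Proof. intros. unfold Fact, fact. apply Rep_el; rep_atom. Qed.

Lemma Rep_value Y e x y d s v V Y' e' x' y' :
  SvV Y s V Y' -> TmV e d v e' -> TmV x d v x' -> TmV y d v y' ->
  Rep M (Value Y e x y) d s v V (value Y' e' x' y').
Proof.
  intros. unfold Value, value, Computation, computation, Justified, justified.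
  repeat first [ rep_step | rep_use Fact Rep_fact ].
Qed.

Lemma Rep_turing_le X Y d s v V X' Y' : SvV X s V X' -> SvV Y s V Y' ->
  Rep M (Turing_le X Y) d s v V (turing_le X' Y').
Proof.
  intros. unfold Turing_le, turing_le.
  repeat first [ rep_step | rep_use Value Rep_value ].
Qed.

Lemma Rep_tree T d s v V T' : SvV T s V T' -> Rep M (Tree T) d s v V (tree T').
Proof.
  intros. unfold Tree, tree.
  repeat first [ rep_step | rep_use Seq Rep_seq | rep_use Initial Rep_initial ].
Qed.

Lemma Rep_path X T d s v V X' T' : SvV X s V X' -> SvV T s V T' ->
  Rep M (Path X T) d s v V (path X' T').
Proof.
  intros. unfold Path, path, IsFunction, isfun.
  repeat first [ rep_step | rep_use Seq Rep_seq | rep_use Entry Rep_entry ].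
Qed.

Lemma Rep_perfect T d s v V T' : SvV T s V T' -> Rep M (Perfect T) d s v V (perfect T').
Proof.
  intros. unfold Perfect, perfect.
  repeat first [ rep_step | rep_use Tree Rep_tree | rep_use Initial Rep_initial
               | rep_use Incompatible Rep_incompat ].
Qed.

Lemma sat_MPT v V : sat M v V MPT <->
  forall T, M T ->
    tree T /\ (forall X, M X -> exists Y, M Y /\ path Y T /\ turing_le X Y) ->
    exists S, M S /\ (forall n, S n -> T n) /\
      perfect S /\ (forall X, M X -> path X S -> turing_le S X).
Proof.
  change (Rep M MPT_formula 0 0 v V
  (forall T, M T ->
    tree T /\ (forall X, M X -> exists Y, M Y /\ path Y T /\ turing_le X Y) ->
    exists S, M S /\ (forall n, S n -> T n) /\
      perfect S /\ (forall X, M X -> path X S -> turing_le S X))).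
  unfold MPT_formula, Cofinal_paths, Subset, Pointed.
  repeat first [ rep_step | rep_use Tree Rep_tree | rep_use Path Rep_path
               | rep_use Turing_le Rep_turing_le | rep_use Perfect Rep_perfect ].
Qed.

Lemma sat_WKL v V : sat M v V WKL <->
  forall T, M T ->
    tree T /\ (forall s i v, T s /\ entry s i v -> v < 2) /\
    ~ (exists k, forall n, T n -> n < k) ->
    exists X, M X /\ path X T.
Proof.
  change (Rep M WKL_formula 0 0 v V
  (forall T, M T ->
    tree T /\ (forall s i v, T s /\ entry s i v -> v < 2) /\
    ~ (exists k, forall n, T n -> n < k) ->
    exists X, M X /\ path X T)).
  unfold WKL_formula, Binary, Infinite.
  repeat first [ rep_step | rep_use Tree Rep_tree | rep_use Path Rep_path | rep_use Entry Rep_entry ].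
Qed.

End RepCoding.

(** * Coding of finite sets and sequences *)

(** The code lies between the squares of [i + j] and [i + j + 1], so it determines the sum, and then
    [i]. *)
Lemma cpair_inj i j i' j' : cpair i j = cpair i' j' -> i = i' /\ j = j'.
Proof.
  unfold cpair. intros H.
  assert (i + j = i' + j') by (destruct (Nat.lt_trichotomy (i + j) (i' + j')) as [?|[?|?]]; nia).
  nia.
Qed.

Lemma cpair_le i j : i <= cpair i j /\ j <= cpair i j.
Proof. unfold cpair. nia. Qed.

Lemma el_lt x c : el x c -> x < c.
Proof.
  intros (k & m & n & -> & H & _).
  destruct (cpair_le (cpair k m) n), (cpair_le k m). lia.
Qed.

Lemma entry_lt s i v : entry s i v -> i < s /\ v < s.
Proof. intros H%el_lt. destruct (cpair_le i v). lia. Qed.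

Lemma fact_divide n d : 0 < d <= n -> Nat.divide d (Factorial.fact n).
Proof.
  induction n as [|n IH]; intros H; [lia|].
  change (Factorial.fact (S n)) with (S n * Factorial.fact n).
  destruct (Nat.eq_dec d (S n)) as [->|Hd]; [apply Nat.divide_factor_l|].
  apply Nat.divide_mul_r, IH. lia.
Qed.

(** A common divisor is prime to [m = n!] and divides [m * (y - x)], hence divides [y - x]. As
    [0 < y - x <= n], it then divides [m], and so it divides 1. *)
Lemma divisors_coprime n x y : x < y < n ->
  Nat.gcd (Factorial.fact n * (x + 1) + 1) (Factorial.fact n * (y + 1) + 1) = 1.
Proof.
  intros H. set (m := Factorial.fact n).
  set (g := Nat.gcd _ _).
  assert (Hx : Nat.divide g (m * (x + 1) + 1)) by apply Nat.gcd_divide_l.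
  assert (Hy : Nat.divide g (m * (y + 1) + 1)) by apply Nat.gcd_divide_r.
  assert (Hm : Nat.gcd g m = 1).
  { apply Nat.divide_1_r.
    apply (Nat.divide_add_cancel_r _ (m * (x + 1)) 1).
    - apply Nat.divide_mul_l, Nat.gcd_divide_r.
    - eapply Nat.divide_trans; [apply Nat.gcd_divide_l|exact Hx]. }
  assert (Hd : Nat.divide g (m * (y - x))).
  { apply (Nat.divide_add_cancel_r _ (m * (x + 1) + 1)); [exact Hx|].
    replace (m * (x + 1) + 1 + m * (y - x)) with (m * (y + 1) + 1) by nia. exact Hy. }
  apply Nat.gauss in Hd; [|exact Hm].
  assert (Hgm : Nat.divide g m).
  { eapply Nat.divide_trans; [exact Hd|]. apply fact_divide. lia. }
  apply Nat.divide_1_r.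
  apply (Nat.divide_add_cancel_r _ (m * (x + 1))); [now apply Nat.divide_mul_l|exact Hx].
Qed.

(* Goedel's beta function: the divisors [m (x + 1) + 1] with [m = n!] and
   [x < n] are pairwise coprime. *)
Lemma setcode_exists (P : nat -> Prop) n :
  exists c, setcode c /\ forall x, el x c <-> x < n /\ P x.
Proof.
  set (m := Factorial.fact n). set (f := fun x => m * (x + 1) + 1).
  assert (Hm : 1 <= m) by (unfold m; pose proof (Factorial.fact_neq_0 n); lia).
  assert (H : forall j, j <= n -> exists N,
    forall x, x < n -> (Nat.divide (f x) N <-> x < j /\ P x)).
  { induction j as [|j IH]; intros Hj.
    - exists 1. intros x Hx. split; [|lia].
      intros E%Nat.divide_1_r. unfold f in E. nia.
    - destruct IH as (N & HN); [lia|].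
      destruct (classic (P j)) as [Pj|Pj].
      + exists (f j * N). intros x Hx. destruct (Nat.eq_dec x j) as [->|Hne].
        * split; [auto with arith|]. intros _. apply Nat.divide_factor_l.
        * transitivity (Nat.divide (f x) N); [|rewrite HN by lia; split; intros []; split; auto; lia].
          split; [|apply Nat.divide_mul_r].
          intros D. apply Nat.gauss in D; [exact D|]. unfold f, m.
          destruct (Nat.lt_total x j) as [|[|]]; [|lia|rewrite Nat.gcd_comm];
            apply divisors_coprime; lia.
      + exists N. intros x Hx. rewrite HN by lia.
        split; intros [H1 H2]; (split; [|exact H2]); [lia|].
        destruct (Nat.eq_dec x j) as [->|]; [tauto|lia]. }
  destruct (H n) as (N & HN); [lia|].
  exists (cpair (cpair n m) N). split; [exists n, m, N; reflexivity|].
  intros x. split.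
  - intros (k & m' & n' & E & Hx & q & Hq).
    apply cpair_inj in E as [E <-]. apply cpair_inj in E as [<- <-].
    apply HN; [exact Hx|]. exists q. exact Hq.
  - intros [Hx Px]. exists n, m, N. split; [reflexivity|]. split; [exact Hx|].
    apply HN; auto.
Qed.

Lemma finset_of_setcode c : setcode c -> exists b, finset b /\ forall x, el x b <-> el x c.
Proof.
  induction c as [c IH] using lt_wf_ind. intros Hc.
  destruct (classic (exists b, (b < c /\ setcode b) /\ forall x, el x b <-> el x c))
    as [(b & [Hbc Hb] & E)|N].
  - destruct (IH b Hbc Hb) as (b' & Hb' & E'). exists b'. split; [exact Hb'|].
    intros x. now rewrite E'.
  - exists c. split; [|reflexivity]. split; [exact Hc|].
    intros b Hb E. apply N. exists b. auto.
Qed.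

(** Finite collection: monotonicity in the second argument lets one bound serve every [i < n]. *)
Lemma bounded_choice (n : nat) (P : nat -> nat -> Prop) :
  (forall i a b, P i a -> a <= b -> P i b) ->
  (forall i, i < n -> exists a, P i a) -> exists b, forall i, i < n -> P i b.
Proof.
  intros HP. induction n as [|n IH]; intros H; [exists 0; lia|].
  destruct IH as (b & Hb); [auto|]. destruct (H n) as (a & Ha); [lia|].
  exists (a + b). intros i Hi. destruct (Nat.eq_dec i n) as [->|].
  - apply (HP _ _ _ Ha). lia.
  - apply (HP _ b); [apply Hb; lia|lia].
Qed.

Lemma seq_exists (f : nat -> nat) (l : nat) :
  exists s, isseq s /\ forall i v, entry s i v <-> i < l /\ v = f i.
Proof.
  destruct (bounded_choice l (fun i b => cpair i (f i) < b)) as (b & Hb);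
    [intros; lia|intros i _; exists (S (cpair i (f i))); lia|].
  destruct (setcode_exists (fun x => exists i, i < l /\ x = cpair i (f i)) b) as (c & Hc & E).
  destruct (finset_of_setcode c Hc) as (s & Hs & E').
  assert (K : forall x, el x s <-> exists i, i < l /\ x = cpair i (f i)).
  { intros x. rewrite E', E. split; [tauto|].
    intros (i & Hi & ->). split; [auto|exists i; auto]. }
  assert (K' : forall i v, entry s i v <-> i < l /\ v = f i).
  { intros i v. unfold entry. rewrite K. split.
    - intros (j & Hj & [-> ->]%cpair_inj). auto.
    - intros [Hi ->]. exists i. auto. }
  exists s. split; [|exact K']. split; [exact Hs|]. split; [|split].
  - intros x (i & _ & ->)%K. eauto.
  - intros i v w [[_ ->]%K' [_ ->]%K']. reflexivity.
  - exists l. intros i. split.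
    + intros Hi. exists (f i). apply K'. auto.
    + intros (v & [Hi _]%K'). exact Hi.
Qed.

(** * Relative computability *)

Definition env := nat -> nat.
Definition sh (v : env) : env := fun i => v (S i).

(** Polynomials suffice as terms because pairing is one. Their closure under substitution gives
    [ar_subst]; other functions enter through their graphs. *)
Inductive Pol : (env -> nat) -> Prop :=
| pol_var i : Pol (fun v => v i)
| pol_const c : Pol (fun _ => c)
| pol_add t u : Pol t -> Pol u -> Pol (fun v => t v + u v)
| pol_mul t u : Pol t -> Pol u -> Pol (fun v => t v * u v).

Lemma pol_S t : Pol t -> Pol (fun v => S (t v)).
Proof. intros H. exact (pol_add _ _ (pol_const 1) H). Qed.

Lemma pol_cpair t u : Pol t -> Pol u -> Pol (fun v => cpair (t v) (u v)).
Proof. intros. unfold cpair. repeat (assumption || apply pol_add || apply pol_mul). Qed.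

Lemma pol_ix n t u : Pol t -> Pol u -> Pol (fun v => ix n (t v) (u v)).
Proof. intros. unfold ix. repeat apply pol_cpair; [apply pol_const|assumption..]. Qed.

Lemma pol_subst t (s : nat -> env -> nat) : Pol t -> (forall i, Pol (s i)) ->
  Pol (fun v => t (fun i => s i v)).
Proof.
  intros Ht Hs. induction Ht;
    [apply Hs|apply (pol_const c)|apply (pol_add _ _ IHHt1 IHHt2)|apply (pol_mul _ _ IHHt1 IHHt2)].
Qed.

Lemma pol_sh t : Pol t -> Pol (fun v => t (sh v)).
Proof. intros H. apply (pol_subst t (fun i v => v (S i)) H). intros i. apply pol_var. Qed.

(* Relations on numbers that are arithmetical in [Y] with bounded quantifiers
   and, when [ub] holds, unbounded existential quantifiers: these are the
   relations bounded in [Y] for [ub = False] and those semi-decidable in [Y]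
   for [ub = True]. *)
Inductive Ar (ub : Prop) (Y : nat -> Prop) : (env -> Prop) -> Prop :=
| ar_eq t u : Pol t -> Pol u -> Ar ub Y (fun v => t v = u v)
| ar_in t : Pol t -> Ar ub Y (fun v => Y (t v))
| ar_notin t : Pol t -> Ar ub Y (fun v => ~ Y (t v))
| ar_and P Q : Ar ub Y P -> Ar ub Y Q -> Ar ub Y (fun v => P v /\ Q v)
| ar_or P Q : Ar ub Y P -> Ar ub Y Q -> Ar ub Y (fun v => P v \/ Q v)
| ar_bex t P : Pol t -> Ar ub Y P -> Ar ub Y (fun v => exists x, x <= t v /\ P (scons x v))
| ar_ball t P : Pol t -> Ar ub Y P -> Ar ub Y (fun v => forall x, x < t v -> P (scons x v))
| ar_ex P : ub -> Ar ub Y P -> Ar ub Y (fun v => exists x, P (scons x v))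
| ar_ext P Q : (forall v, P v <-> Q v) -> Ar ub Y P -> Ar ub Y Q.

Notation Sig := (Ar True).
Notation Dl := (Ar False).

Definition Sig1 Y (R : nat -> Prop) := Sig Y (fun v => R (v 0)).
Definition Sig2 Y (R : nat -> nat -> Prop) := Sig Y (fun v => R (v 0) (v 1)).
Definition Sig3 Y (R : nat -> nat -> nat -> Prop) := Sig Y (fun v => R (v 0) (v 1) (v 2)).
Definition Sig4 Y (R : nat -> nat -> nat -> nat -> Prop) :=
  Sig Y (fun v => R (v 0) (v 1) (v 2) (v 3)).

Definition lift (s : nat -> env -> nat) (i : nat) : env -> nat :=
  match i with O => fun v => v 0 | S i => fun v => s i (sh v) end.

Lemma lift_pol s : (forall i, Pol (s i)) -> forall i, Pol (lift s i).
Proof. intros H [|i]; simpl; [apply pol_var|apply pol_sh, H]. Qed.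

Lemma lift_scons s x v : (fun i => lift s i (scons x v)) = scons x (fun i => s i v).
Proof. apply functional_extensionality. intros [|i]; reflexivity. Qed.

Lemma ar_subst ub Y P : Ar ub Y P -> forall s, (forall i, Pol (s i)) ->
  Ar ub Y (fun v => P (fun i => s i v)).
Proof.
  induction 1; intros s Hs.
  - apply (ar_eq ub Y (fun v => t (fun i => s i v)) (fun v => u (fun i => s i v)));
      apply pol_subst; assumption.
  - apply (ar_in ub Y (fun v => t (fun i => s i v))), pol_subst; assumption.
  - apply (ar_notin ub Y (fun v => t (fun i => s i v))), pol_subst; assumption.
  - apply (ar_and _ _ _ _ (IHAr1 s Hs) (IHAr2 s Hs)).
  - apply (ar_or _ _ _ _ (IHAr1 s Hs) (IHAr2 s Hs)).
  - eapply ar_ext; [|apply (ar_bex ub Y (fun v => t (fun i => s i v)) _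
      (pol_subst _ _ H Hs) (IHAr (lift s) (lift_pol s Hs)))].
    intros v. split; intros (x & Hx); exists x; rewrite lift_scons in *; exact Hx.
  - eapply ar_ext; [|apply (ar_ball ub Y (fun v => t (fun i => s i v)) _
      (pol_subst _ _ H Hs) (IHAr (lift s) (lift_pol s Hs)))].
    intros v. split; intros K x; specialize (K x); rewrite lift_scons in *; exact K.
  - eapply ar_ext; [|apply (ar_ex ub Y _ H (IHAr (lift s) (lift_pol s Hs)))].
    intros v. split; intros (x & Hx); exists x; rewrite lift_scons in *; exact Hx.
  - eapply ar_ext; [|apply (IHAr s Hs)]. intros v. apply H.
Qed.

Lemma dl_sig Y P : Dl Y P -> Sig Y P.
Proof. induction 1; [constructor; auto..|eapply ar_ext; eauto]. Qed.

Lemma least_nat (P : nat -> Prop) n : P n -> exists m, P m /\ forall i, i < m -> ~ P i.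
Proof.
  induction n as [n IH] using lt_wf_ind. intros Hn.
  destruct (classic (exists i, i < n /\ P i)) as [(i & Hi & Pi)|N]; [exact (IH i Hi Pi)|].
  exists n. split; [exact Hn|]. intros i Hi Pi. apply N. eauto.
Qed.

(** ** Deriving semi-decidability from the shape of a definition *)

(** The bound variable is an argument of [P] of its own, so that unification can read [P] off a
    quantified goal, as the tactic [sig] requires. *)
Lemma sig_ex Y (P : nat -> env -> Prop) :
  Sig Y (fun v => P (v 0) (fun i => v (S i))) -> Sig Y (fun v => exists x, P x v).
Proof. intros H. exact (ar_ex True Y _ I H). Qed.

Lemma sig_ball Y t (P : nat -> env -> Prop) : Pol t ->
  Sig Y (fun v => P (v 0) (fun i => v (S i))) ->
  Sig Y (fun v => forall x, x < t v -> P x v).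
Proof. intros Ht H. exact (ar_ball True Y _ _ Ht H). Qed.

Definition args (l : list (env -> nat)) (i : nat) : env -> nat := nth i l (fun _ => 0).

Lemma args_pol l : Forall Pol l -> forall i, Pol (args l i).
Proof.
  intros H i. unfold args. destruct (Nat.lt_ge_cases i (length l)) as [Hi|Hi].
  - eapply Forall_forall; [exact H|]. now apply nth_In.
  - rewrite nth_overflow by exact Hi. apply pol_const.
Qed.

Lemma sig_use1 Y R t : Sig1 Y R -> Pol t -> Sig Y (fun v => R (t v)).
Proof. intros HR Ht. apply (ar_subst _ _ _ HR (args [t])), args_pol. auto. Qed.
Lemma sig_use2 Y R t u : Sig2 Y R -> Pol t -> Pol u -> Sig Y (fun v => R (t v) (u v)).
Proof. intros HR Ht Hu. apply (ar_subst _ _ _ HR (args [t; u])), args_pol. auto. Qed.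
Lemma sig_use3 Y R t u w : Sig3 Y R -> Pol t -> Pol u -> Pol w ->
  Sig Y (fun v => R (t v) (u v) (w v)).
Proof. intros HR Ht Hu Hw. apply (ar_subst _ _ _ HR (args [t; u; w])), args_pol. auto. Qed.
Lemma sig_use4 Y R t u w z : Sig4 Y R -> Pol t -> Pol u -> Pol w -> Pol z ->
  Sig Y (fun v => R (t v) (u v) (w v) (z v)).
Proof. intros HR Ht Hu Hw Hz. apply (ar_subst _ _ _ HR (args [t; u; w; z])), args_pol. auto. Qed.

Ltac pol := solve [repeat first
  [ assumption | apply pol_var | apply pol_const | apply pol_S | apply pol_cpair | apply pol_ix
  | apply pol_add | apply pol_mul ]].

Ltac sig_fact := fail.
Ltac sig_step :=
  cbv beta;
  lazymatch goal with
  | |- Sig1 _ _ => unfold Sig1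
  | |- Sig2 _ _ => unfold Sig2
  | |- Sig3 _ _ => unfold Sig3
  | |- Sig4 _ _ => unfold Sig4
  | |- Ar _ _ (fun v => _ /\ _) => apply ar_and
  | |- Ar _ _ (fun v => _ \/ _) => apply ar_or
  | |- Ar _ _ (fun v => exists x, _) => apply sig_ex
  | |- Ar _ _ (fun v => forall x, x < _ -> _) => apply sig_ball; [pol|]
  | |- _ => first
    [ apply ar_eq; pol
    | match goal with
      | H : Sig1 _ _ |- _ => apply (sig_use1 _ _ _ H); pol
      | H : Sig2 _ _ |- _ => apply (sig_use2 _ _ _ _ H); pol
      | H : Sig3 _ _ |- _ => apply (sig_use3 _ _ _ _ _ H); pol
      | H : Sig4 _ _ |- _ => apply (sig_use4 _ _ _ _ _ _ H); pol
      end
    | sig_fact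
    | apply ar_in; pol
    | apply ar_notin; pol ]
  end.
Ltac sig := repeat sig_step.

Lemma sig_lt Y : Sig2 Y lt.
Proof.
  eapply ar_ext with (P := fun v => exists z, v 0 + S z = v 1); [|sig].
  intros v. split; [intros (z & H); lia|]. intros H. exists (v 1 - S (v 0)). lia.
Qed.

Lemma sig_le Y : Sig2 Y le.
Proof.
  eapply ar_ext with (P := fun v => exists z, v 0 + z = v 1); [|sig].
  intros v. split; [intros (z & H); lia|]. intros H. exists (v 1 - v 0). lia.
Qed.

Lemma sig_nlt Y : Sig2 Y (fun x y => ~ x < y).
Proof.
  eapply ar_ext with (P := fun v => exists z, v 1 + z = v 0); [|sig].
  intros v. split; [intros (z & H); lia|]. intros H. exists (v 0 - v 1). lia.
Qed.

Ltac sig_order :=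
  lazymatch goal with
  | |- Ar _ ?Y (fun v => _ < _) => apply (sig_use2 Y lt _ _ (sig_lt Y)); pol
  | |- Ar _ ?Y (fun v => ~ _ < _) => apply (sig_use2 Y _ _ _ (sig_nlt Y)); pol
  | |- Ar _ ?Y (fun v => _ <= _) => apply (sig_use2 Y le _ _ (sig_le Y)); pol
  end.
Ltac sig_fact ::= sig_order.

Lemma sig_neq Y : Sig2 Y (fun x y => x <> y).
Proof.
  eapply ar_ext with (P := fun v => v 0 < v 1 \/ v 1 < v 0); [|sig]. intros v. lia.
Qed.

Lemma sig_el Y : Sig2 Y el.
Proof. unfold el. sig. Qed.

(** All quantifiers in [el] are bounded by the code: [k], [m], [n] because pairing dominates its
    arguments, and [q] by [n] because the divisor is positive. The complement is thus a bounded
    universal statement. *)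
Lemma sig_nel Y : Sig2 Y (fun x c => ~ el x c).
Proof.
  pose proof (sig_neq Y) as Hneq.
  eapply ar_ext with (P := fun v => forall k, k < S (v 1) -> forall m, m < S (v 1) ->
    forall n, n < S (v 1) -> v 1 <> cpair (cpair k m) n \/ k <= v 0 \/
      forall q, q < S n -> n <> q * (m * (v 0 + 1) + 1)); [|sig].
  intros v. split.
  - intros H (k & m & n & E & Hk & q & Hq).
    destruct (cpair_le (cpair k m) n), (cpair_le k m).
    destruct (H k ltac:(lia) m ltac:(lia) n ltac:(lia)) as [H'|[H'|H']]; [tauto|lia|].
    apply (H' q); [nia|exact Hq].
  - intros H k _ m _ n _. destruct (Nat.eq_dec (v 1) (cpair (cpair k m) n)) as [E|E]; [|auto].
    destruct (Nat.lt_ge_cases (v 0) k) as [Hk|Hk]; [|auto]. right; right.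
    intros q _ Hq. apply H. exists k, m, n. eauto.
Qed.

Lemma sig_setcode Y : Sig1 Y setcode.
Proof. unfold setcode. sig. Qed.

Lemma sig_nsetcode Y : Sig1 Y (fun c => ~ setcode c).
Proof.
  pose proof (sig_neq Y) as Hneq.
  eapply ar_ext with (P := fun v => forall k, k < S (v 0) -> forall m, m < S (v 0) ->
    forall n, n < S (v 0) -> v 0 <> cpair (cpair k m) n); [|sig].
  intros v. split.
  - intros H (k & m & n & E).
    destruct (cpair_le (cpair k m) n), (cpair_le k m).
    apply (H k ltac:(lia) m ltac:(lia) n ltac:(lia) E).
  - intros H k _ m _ n _ E. apply H. exists k, m, n. exact E.
Qed.

Ltac sig_coding :=
  lazymatch goal with
  | |- Ar _ ?Y (fun v => el _ _) => apply (sig_use2 Y el _ _ (sig_el Y)); pol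
  | |- Ar _ ?Y (fun v => ~ el _ _) => apply (sig_use2 Y _ _ _ (sig_nel Y)); pol
  | |- Ar _ ?Y (fun v => ~ @eq nat _ _) => apply (sig_use2 Y _ _ _ (sig_neq Y)); pol
  | |- Ar _ ?Y (fun v => setcode _) => apply (sig_use1 Y _ _ (sig_setcode Y)); pol
  | |- Ar _ ?Y (fun v => ~ setcode _) => apply (sig_use1 Y _ _ (sig_nsetcode Y)); pol
  | |- Ar _ ?Y (fun v => entry _ _ _) => unfold entry
  | |- Ar _ ?Y (fun v => ~ entry _ _ _) => unfold entry
  | |- Ar _ ?Y (fun v => fact _ _ _ _) => unfold fact
  | |- Ar _ ?Y (fun v => ~ fact _ _ _ _) => unfold fact
  | |- _ => sig_order
  end.
Ltac sig_fact ::= sig_coding.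

Lemma sig_finset Y : Sig1 Y finset.
Proof.
  eapply ar_ext with (P := fun v => setcode (v 0) /\ forall b, b < v 0 ->
    ~ setcode b \/ exists x, (el x b /\ ~ el x (v 0)) \/ (~ el x b /\ el x (v 0))); [|sig].
  intros v. unfold finset. split; intros [H1 H2]; (split; [exact H1|]).
  - intros b [Hb Sb] E. destruct (H2 b Hb) as [N|(x & Hx)]; [tauto|].
    specialize (E x). tauto.
  - intros b Hb. destruct (classic (setcode b)) as [Sb|]; [right|auto].
    apply NNPP. intros N. apply (H2 b (conj Hb Sb)). intros x.
    split; intros Hx; apply NNPP; intros Nx; apply N; exists x; tauto.
Qed.

Lemma sig_nfinset Y : Sig1 Y (fun c => ~ finset c).
Proof.
  eapply ar_ext with (P := fun v => ~ setcode (v 0) \/ exists b, b < v 0 /\ setcode b /\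
    forall x, x < v 0 -> (el x b /\ el x (v 0)) \/ (~ el x b /\ ~ el x (v 0))); [|sig].
  intros v. unfold finset. split.
  - intros [H|(b & Hb & Sb & H)] [H1 H2]; [tauto|]. apply (H2 b (conj Hb Sb)).
    intros x. destruct (Nat.lt_ge_cases x (v 0)) as [Hx|Hx]; [specialize (H x Hx); tauto|].
    split; intros K%el_lt; lia.
  - intros H. destruct (classic (setcode (v 0))) as [S0|]; [right|auto].
    apply NNPP. intros N. apply H. split; [exact S0|]. intros b [Hb Sb] E. apply N.
    exists b. split; [exact Hb|]. split; [exact Sb|]. intros x _. specialize (E x).
    destruct (classic (el x b)); tauto.
Qed.

(* A coded sequence is shorter than its code, which bounds all quantifiers. *)
Lemma isseq_bounded s : isseq s <->
  finset s /\
  (forall x, x < s -> ~ el x s \/ exists i v, i < s /\ v < s /\ x = cpair i v) /\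
  (forall i, i < s -> forall v, v < s -> forall w, w < s ->
     ~ entry s i v \/ ~ entry s i w \/ v = w) /\
  (exists l, l <= s /\ forall i, i < s ->
     (i < l /\ exists v, v < s /\ entry s i v) \/
     (l <= i /\ forall v, v < s -> ~ entry s i v)).
Proof.
  split.
  - intros (H1 & H2 & H3 & l & H4). split; [exact H1|]. split; [|split].
    + intros x _. destruct (classic (el x s)) as [Hx|]; [right|auto].
      destruct (H2 x Hx) as (i & v & ->). exists i, v.
      apply entry_lt in Hx as []. auto.
    + intros i _ v _ w _. destruct (classic (entry s i v)); [|auto].
      destruct (classic (entry s i w)); [|auto]. right; right. apply (H3 i v w). auto.
    + exists l. split.
      * destruct l as [|l]; [lia|]. destruct (proj1 (H4 l) ltac:(lia)) as (v & Hv).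
        apply entry_lt in Hv. lia.
      * intros i Hi. destruct (Nat.lt_ge_cases i l) as [Hl|Hl]; [left|right]; (split; [exact Hl|]).
        -- apply H4 in Hl as (v & Hv). exists v. split; [apply (entry_lt _ _ _ Hv)|exact Hv].
        -- intros v _ Hv. assert (i < l) by (apply H4; eauto). lia.
  - intros (H1 & H2 & H3 & l & Hl & H4). split; [exact H1|]. split; [|split].
    + intros x Hx. destruct (H2 x (el_lt _ _ Hx)) as [|(i & v & _ & _ & E)]; [tauto|eauto].
    + intros i v w [Hv Hw]. destruct (entry_lt _ _ _ Hv), (entry_lt _ _ _ Hw).
      destruct (H3 i ltac:(auto) v ltac:(auto) w ltac:(auto)); tauto.
    + exists l. intros i. split.
      * intros Hi. destruct (H4 i ltac:(lia)) as [(_ & v & _ & Hv)|]; [eauto|lia].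
      * intros (v & Hv). destruct (entry_lt _ _ _ Hv) as [Hi Hv'].
        destruct (H4 i Hi) as [|[_ K]]; [tauto|]. destruct (K v Hv' Hv).
Qed.

Lemma sig_isseq Y : Sig1 Y isseq.
Proof.
  pose proof (sig_finset Y) as Hf.
  eapply ar_ext; [intros v; symmetry; apply isseq_bounded|]. sig.
Qed.

Lemma sig_nisseq Y : Sig1 Y (fun s => ~ isseq s).
Proof.
  pose proof (sig_nfinset Y) as Hf.
  eapply ar_ext with (P := fun v => ~ finset (v 0) \/
  (exists x, el x (v 0) /\ forall i, i < v 0 -> forall w, w < v 0 -> x <> cpair i w) \/
  (exists i a b, entry (v 0) i a /\ entry (v 0) i b /\ a <> b) \/
  (exists i j a, i <= j /\ entry (v 0) j a /\ forall b, b < v 0 -> ~ entry (v 0) i b)); [|sig].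
  intros v. set (s := v 0). split.
  - intros H (H1 & H2 & H3 & l & H4). destruct H as [H|[H|[H|H]]].
    + tauto.
    + destruct H as (x & Hx & H). destruct (H2 x Hx) as (i & w & ->).
      destruct (entry_lt _ _ _ Hx). apply (H i ltac:(auto) w ltac:(auto) eq_refl).
    + destruct H as (i & a & b & Ha & Hb & N). apply N, (H3 i a b). auto.
    + destruct H as (i & j & a & Hij & Ha & H).
      assert (Hj : j < l) by (apply H4; eauto).
      destruct (proj1 (H4 i) ltac:(lia)) as (b & Hb).
      apply (H b); [apply (entry_lt _ _ _ Hb)|exact Hb].
  - intros N. apply NNPP. intros K. apply N. split; [|split; [|split]].
    + apply NNPP. tauto.
    + intros x Hx. apply NNPP. intros L. apply K. right; left. exists x. split; [exact Hx|].
      intros i _ w _ E. apply L. eauto.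
    + intros i a b [Ha Hb]. apply NNPP. intros L. apply K. right; right; left. exists i, a, b. auto.
    (* An index in the domain is smaller than the code [s], so [s] itself is missing; the least
       missing index is the length. *)
    + assert (Hs : ~ exists v, entry s s v).
      { intros (a & Ha). apply entry_lt in Ha. lia. }
      destruct (least_nat (fun i => ~ exists v, entry s i v) _ Hs) as (l & Hl & D0).
      assert (D : forall i, i < l -> exists v, entry s i v).
      { intros i Hi. apply NNPP, (D0 i Hi). }
      exists l. intros i. split; [apply D|].
      intros (a & Ha). apply NNPP. intros Hi. apply K. right; right; right.
      exists l, i, a. split; [lia|]. split; [exact Ha|]. intros b _ Hb. apply Hl. eauto.
Qed.

Lemma dl_lt ub Y t u : Pol t -> Pol u -> Ar ub Y (fun v => t v < u v).
Proof.
  intros Ht Hu. eapply ar_ext with (P := fun v => exists x, x <= u v /\ t v + S x = u v).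
  - intros v. split; [intros (x & _ & H); lia|].
    intros H. exists (u v - S (t v)). lia.
  - apply (ar_bex ub Y u (fun v => t (sh v) + S (v 0) = u (sh v)) Hu).
    apply ar_eq; [apply pol_add; [apply pol_sh, Ht|apply pol_S, pol_var]|apply pol_sh, Hu].
Qed.

Lemma dl_not Y P : Dl Y P -> Dl Y (fun v => ~ P v).
Proof.
  induction 1.
  - eapply ar_ext with (P := fun v => t v < u v \/ u v < t v); [intros v; lia|].
    apply ar_or; apply dl_lt; assumption.
  - apply ar_notin; assumption.
  - eapply ar_ext with (P := fun v => Y (t v)); [intros v; tauto|]. apply ar_in; assumption.
  - eapply ar_ext; [|apply (ar_or _ _ _ _ IHAr1 IHAr2)]. intros v. simpl. tauto.
  - eapply ar_ext; [|apply (ar_and _ _ _ _ IHAr1 IHAr2)]. intros v. simpl. tauto.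
  - eapply ar_ext; [|apply (ar_ball _ _ _ _ (pol_S _ H) IHAr)]. intros v. split.
    + intros K (x & Hx & Px). apply (K x); [lia|exact Px].
    + intros K x Hx Px. apply K. exists x. split; [lia|exact Px].
  - eapply ar_ext; [|apply (ar_bex _ _ _ _ H (ar_and _ _ _ _ IHAr
      (dl_lt _ Y _ _ (pol_var 0) (pol_sh _ H))))].
    intros v. split.
    + intros (x & _ & Hx & Hxt) K. apply Hx, K, Hxt.
    + intros K. apply NNPP. intros N. apply K. intros x Hx. apply NNPP. intros Px.
      apply N. exists x. split; [lia|]. split; [exact Px|exact Hx].
  - contradiction.
  - eapply ar_ext; [|exact IHAr]. intros v. simpl. now rewrite H.
Qed.

(** Variable 0 of a normal form is its bound [w]. Moving [w] outside a quantifier exchanges it with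
    the quantified variable. *)
Definition swap01 (i : nat) : env -> nat :=
  match i with 0 => fun v => v 1 | 1 => fun v => v 0 | i => fun v => v i end.

Lemma dl_swap01 Y P : Dl Y P -> Dl Y (fun v => P (fun i => swap01 i v)).
Proof. intros H. apply (ar_subst _ _ _ H). intros [|[|i]]; apply pol_var. Qed.

(* The witness [w] bounds all the unbounded quantifiers at once. *)
Lemma normal_form Y P : Sig Y P -> exists Q, Dl Y Q /\
  (forall w w' v, w <= w' -> Q (scons w v) -> Q (scons w' v)) /\
  forall v, P v <-> exists w, Q (scons w v).
Proof.
  induction 1.
  - exists (fun v => t (sh v) = u (sh v)). split; [|split].
    + apply ar_eq; apply pol_sh; assumption.
    + intros w w' v _. exact (fun e => e).
    + intros v. split; [intros E; exists 0; exact E|intros (w & E); exact E].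
  - exists (fun v => Y (t (sh v))). split; [|split].
    + apply (ar_in _ _ (fun v => t (sh v))), pol_sh; assumption.
    + intros w w' v _. exact (fun e => e).
    + intros v. split; [intros E; exists 0; exact E|intros (w & E); exact E].
  - exists (fun v => ~ Y (t (sh v))). split; [|split].
    + apply (ar_notin _ _ (fun v => t (sh v))), pol_sh; assumption.
    + intros w w' v _. exact (fun e => e).
    + intros v. split; [intros E; exists 0; exact E|intros (w & E); exact E].
  - destruct IHAr1 as (P' & D1 & M1 & E1), IHAr2 as (Q' & D2 & M2 & E2).
    exists (fun v => P' v /\ Q' v). split; [|split].
    + apply ar_and; assumption.
    + intros w w' v Hw [HP HQ]. eauto.
    + intros v. rewrite E1, E2. split.
      * intros [(w & Hw) (w' & Hw')]. exists (w + w').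
        split; [apply (M1 w)|apply (M2 w')]; (lia || assumption).
      * intros (w & Hw & Hw'). eauto.
  - destruct IHAr1 as (P' & D1 & M1 & E1), IHAr2 as (Q' & D2 & M2 & E2).
    exists (fun v => P' v \/ Q' v). split; [|split].
    + apply ar_or; assumption.
    + intros w w' v Hw [HP|HQ]; eauto.
    + intros v. rewrite E1, E2. split.
      * intros [(w & Hw)|(w & Hw)]; exists w; auto.
      * intros (w & [Hw|Hw]); eauto.
  - destruct IHAr as (Q & D & M & E).
    exists (fun v => exists x, x <= t (sh v) /\ Q (scons (v 0) (scons x (sh v)))). split; [|split].
    + eapply ar_ext; [|apply (ar_bex _ _ (fun v => t (sh v)) _ (pol_sh _ H) (dl_swap01 _ _ D))].
      intros v.
      assert (K : forall x, (fun i => swap01 i (scons x v)) = scons (v 0) (scons x (sh v)))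
        by (intros x; apply functional_extensionality; intros [|[|i]]; reflexivity).
      split; intros (x & Hx); exists x; rewrite K in *; exact Hx.
    + intros w w' v Hw (x & Hx & HQ). exists x. split; [exact Hx|]. eapply M; eassumption.
    + intros v. split.
      * intros (x & Hx & (w & Hw)%E). exists w, x. auto.
      * intros (w & x & Hx & Hw). exists x. split; [exact Hx|]. apply E. eauto.
  - destruct IHAr as (Q & D & M & E).
    exists (fun v => forall x, x < t (sh v) -> Q (scons (v 0) (scons x (sh v)))). split; [|split].
    + eapply ar_ext; [|apply (ar_ball _ _ (fun v => t (sh v)) _ (pol_sh _ H) (dl_swap01 _ _ D))].
      intros v.
      assert (K : forall x, (fun i => swap01 i (scons x v)) = scons (v 0) (scons x (sh v)))
        by (intros x; apply functional_extensionality; intros [|[|i]]; reflexivity).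
      split; intros L x; specialize (L x); rewrite K in *; exact L.
    + intros w w' v Hw L x Hx. eapply M; [exact Hw|]. apply (L x Hx).
    + intros v. split.
      * intros L. apply (bounded_choice (t v) (fun x w => Q (scons w (scons x v)))); [eauto|].
        intros x Hx. apply E, L, Hx.
      * intros (w & L) x Hx. apply E. exists w. apply L, Hx.
  - destruct IHAr as (Q & D & M & E).
    exists (fun v => exists x, x <= v 0 /\ Q (scons (v 0) (scons x (sh v)))). split; [|split].
    + eapply ar_ext; [|apply (ar_bex _ _ (fun v => v 0) _ (pol_var 0) (dl_swap01 _ _ D))].
      intros v.
      assert (K : forall x, (fun i => swap01 i (scons x v)) = scons (v 0) (scons x (sh v)))
        by (intros x; apply functional_extensionality; intros [|[|i]]; reflexivity).
      split; intros (x & Hx); exists x; rewrite K in *; exact Hx.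
    + intros w w' v Hw (x & Hx & HQ). simpl in *. exists x. split; [lia|]. eapply M; eassumption.
    + intros v. split.
      * intros (x & (w & Hw)%E). exists (x + w), x. simpl. split; [lia|].
        apply (M w); [lia|exact Hw].
      * intros (w & x & Hx & Hw). exists x. apply E. eauto.
  - destruct IHAr as (R & D & M & E). exists R. split; [exact D|]. split; [exact M|].
    intros v. now rewrite <- H.
Qed.

(** ** Functions with semi-decidable graph *)

(** Uniformization: [F x] is read off the least coded pair of a witness [w] and a value [y]. With
    the witness explicit the matrix [q] is decidable, so leastness is a bounded search. *)
Lemma selection Y (R : nat -> nat -> Prop) : Sig2 Y R -> (forall x, exists y, R x y) ->
  exists F : nat -> nat, (forall x, R x (F x)) /\ Sig2 Y (fun x y => y = F x).
Proof.
  intros HR Htot. apply normal_form in HR as (Q & D & _ & E).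
  set (q := fun w x y => Q (scons w (scons x (scons y (fun _ => 0))))).
  assert (Eq : forall x y, R x y <-> exists w, q w x y).
  { intros x y. apply (E (scons x (scons y (fun _ => 0)))). }
  assert (Hq : Sig3 Y q).
  { eapply ar_ext; [|apply (ar_subst _ _ _ (dl_sig _ _ D) (args [fun v => v 0; fun v => v 1; fun v => v 2]))].
    - intros v. unfold q. match goal with |- Q ?a <-> Q ?b => replace a with b; [reflexivity|] end.
      apply functional_extensionality. intros [|[|[|[|i]]]]; reflexivity.
    - apply args_pol. repeat constructor. }
  assert (Hnq : Sig3 Y (fun w x y => ~ q w x y)).
  { eapply ar_ext; [|apply (ar_subst _ _ _ (dl_sig _ _ (dl_not _ _ D))
      (args [fun v => v 0; fun v => v 1; fun v => v 2]))].
    - intros v. unfold q. match goal with |- ~ Q ?a <-> ~ Q ?b => replace a with b; [reflexivity|] end.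
      apply functional_extensionality. intros [|[|[|[|i]]]]; reflexivity.
    - apply args_pol. repeat constructor. }
  set (S0 := fun x y => exists w, q w x y /\ forall z, z < cpair w y ->
    forall w', w' < S z -> forall y', y' < S z -> z <> cpair w' y' \/ ~ q w' x y').
  assert (HS : Sig2 Y S0) by (unfold S0; sig).
  assert (Hmin : forall x, exists y, S0 x y).
  { intros x. destruct (Htot x) as (y & (w & Hw)%Eq).
    destruct (least_nat (fun z => exists w y, z = cpair w y /\ q w x y) (cpair w y))
      as (z & (w0 & y0 & -> & H0) & Hz); [eauto|].
    exists y0, w0. split; [exact H0|]. intros z Hlt w' _ y' _.
    destruct (Nat.eq_dec z (cpair w' y')) as [->|]; [right|auto].
    intros K. apply (Hz _ Hlt). eauto. }
  assert (Hfun : forall x y y', S0 x y -> S0 x y' -> y = y').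
  { intros x y y' (w & Hw & Hl) (w' & Hw' & Hl').
    destruct (Nat.lt_trichotomy (cpair w y) (cpair w' y')) as [L|[L|L]].
    - destruct (cpair_le w y). destruct (Hl' _ L w ltac:(lia) y ltac:(lia)); tauto.
    - apply cpair_inj in L. tauto.
    - destruct (cpair_le w' y'). destruct (Hl _ L w' ltac:(lia) y' ltac:(lia)); tauto. }
  exists (fun x => proj1_sig (constructive_indefinite_description _ (Hmin x))). split.
  - intros x. destruct (constructive_indefinite_description _ (Hmin x)) as (y & Hy). simpl.
    destruct Hy as (w & Hw & _). apply Eq. eauto.
  - eapply ar_ext; [|exact HS]. intros v. cbv beta.
    destruct (constructive_indefinite_description _ (Hmin (v 0))) as (y & Hy). simpl. split.
    + intros K. apply (Hfun _ _ _ K Hy).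
    + intros ->. exact Hy.
Qed.

Fixpoint prec (a0 : nat) (F : nat -> nat -> nat -> nat) (t n : nat) : nat :=
  match n with O => a0 | S n => F t n (prec a0 F t n) end.

(** A finite set [c] holds the course of values. Each of its elements is the initial one or follows
    from another element of [c], so by induction on the index [c] contains only correct values. *)
Lemma sig_prec Y a0 F : Sig4 Y (fun t n a b => b = F t n a) ->
  Sig3 Y (fun t n b => b = prec a0 F t n).
Proof.
  intros HF. eapply ar_ext with (P := fun v => exists c, el (cpair (v 1) (v 2)) c /\
    forall z, z < c -> ~ el z c \/ z = cpair 0 a0 \/
      exists i a b, el (cpair i a) c /\ z = cpair (S i) b /\ b = F (v 0) i a).
  - intros v. set (t := v 0). set (n := v 1). split.
    + intros (c & Hc & H).
      assert (K : forall i a, el (cpair i a) c -> a = prec a0 F t i).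
      { induction i as [|i IH]; intros a Ha;
          (destruct (H _ (el_lt _ _ Ha)) as [|[E|(j & a' & b & Hj & E & Eb)]]; [tauto| |]);
          apply cpair_inj in E as [Ei Ea]; try discriminate.
        - exact Ea.
        - injection Ei as <-. simpl. rewrite <- (IH _ Hj). congruence. }
      apply K, Hc.
    + intros Hb.
      destruct (bounded_choice (S n) (fun i b => cpair i (prec a0 F t i) < b)) as (b & Hb');
        [intros; lia|intros i _; eauto|].
      destruct (setcode_exists (fun z => exists i, i <= n /\ z = cpair i (prec a0 F t i)) b)
        as (c & _ & E).
      assert (K : forall z, el z c <-> exists i, i <= n /\ z = cpair i (prec a0 F t i)).
      { intros z. rewrite E. split; [tauto|]. intros (i & Hi & ->).
        split; [apply Hb'; lia|eauto]. }
      exists c. rewrite Hb. split; [apply K; eauto|].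
      intros z _. destruct (classic (el z c)) as [Hz|]; [right|auto].
      apply K in Hz as ([|i] & Hi & ->); [auto|right].
      exists i, (prec a0 F t i), (prec a0 F t (S i)). split; [|auto].
      apply K. exists i. split; [lia|reflexivity].
  - sig.
Qed.

Lemma sig_pow2 Y : Sig2 Y (fun n b => b = 2 ^ n).
Proof.
  assert (H : Sig3 Y (fun t n b => b = prec 1 (fun _ _ a => a + a) t n)).
  { apply sig_prec. sig. }
  eapply ar_ext; [|apply (sig_use3 _ _ (fun _ => 0) (fun v => v 0) (fun v => v 1) H); pol].
  intros v. cbv beta. replace (prec 1 _ 0 (v 0)) with (2 ^ v 0); [reflexivity|].
  induction (v 0) as [|n IH]; [reflexivity|]. simpl prec. rewrite <- IH. simpl. lia.
Qed.

(** ** Programs *)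

Inductive prog : Type :=
| PConst (a : nat) | PId | PFst | PSnd | POrc | PAdd | PMul | PLt
| PPair (p q : prog) | PComp (p q : prog) | PMu (p : prog).

(* The oracle is a relation, possibly partial, so that a finite piece of
   information can be used as an oracle and oracles can be composed. *)
Fixpoint ev (O : nat -> nat -> Prop) (p : prog) (x y : nat) : Prop :=
  match p with
  | PConst a => y = a
  | PId => y = x
  | PFst => exists v, x = cpair y v
  | PSnd => exists u, x = cpair u y
  | POrc => O x y
  | PAdd => exists u v, x = cpair u v /\ y = u + v
  | PMul => exists u v, x = cpair u v /\ y = u * v
  | PLt => exists u v, x = cpair u v /\ ((u < v /\ y = 1) \/ (~ u < v /\ y = 0))
  | PPair p q => exists u v, ev O p x u /\ ev O q x v /\ y = cpair u v
  | PComp p q => exists u, ev O q x u /\ ev O p u y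
  | PMu p => ev O p (cpair x y) 0 /\
      (forall z, z < y -> exists w, ev O p (cpair x z) (w + 1))
  end.

Definition oset (Y : nat -> Prop) (x b : nat) : Prop := (Y x /\ b = 1) \/ (~ Y x /\ b = 0).

Definition functional (O : nat -> nat -> Prop) : Prop :=
  forall x b b', O x b -> O x b' -> b = b'.

Lemma oset_functional Y : functional (oset Y).
Proof. intros x b b' [[] | []] [[] | []]; subst; tauto. Qed.

Lemma ev_functional O p : functional O -> functional (ev O p).
Proof.
  intros HO. induction p; intros x y y'; simpl; intros H H'.
  1,2: congruence.
  1,2: destruct H as (? & ->), H' as (? & E); apply cpair_inj in E; tauto.
  1: exact (HO _ _ _ H H').
  1,2: destruct H as (? & ? & -> & ->), H' as (? & ? & E & ->); apply cpair_inj in E as [-> ->]; reflexivity.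
  - destruct H as (? & ? & -> & H), H' as (? & ? & E & H'). apply cpair_inj in E as [-> ->]. lia.
  - destruct H as (u & v & Hu & Hv & ->), H' as (u' & v' & Hu' & Hv' & ->).
    now rewrite (IHp1 _ _ _ Hu Hu'), (IHp2 _ _ _ Hv Hv').
  - destruct H as (u & Hu & Hy), H' as (u' & Hu' & Hy').
    rewrite (IHp2 _ _ _ Hu Hu') in Hy. exact (IHp1 _ _ _ Hy Hy').
  - destruct H as [H0 H], H' as [H0' H'].
    destruct (Nat.lt_trichotomy y y') as [L|[L|L]]; [|exact L|].
    + destruct (H' _ L) as (w & Hw). pose proof (IHp _ _ _ H0 Hw). lia.
    + destruct (H _ L) as (w & Hw). pose proof (IHp _ _ _ H0' Hw). lia.
Qed.

Lemma ev_mono (O O' : nat -> nat -> Prop) p : (forall x b, O x b -> O' x b) ->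
  forall x y, ev O p x y -> ev O' p x y.
Proof.
  intros HO. induction p; simpl; intros x y H; auto.
  - destruct H as (u & v & Hu & Hv & ->). exists u, v. auto.
  - destruct H as (u & Hu & Hy). eauto.
  - destruct H as [H0 H]. split; [auto|]. intros z Hz. destruct (H z Hz). eauto.
Qed.

(** Use principle: a halting computation consults the union of a directed family of partial oracles
    finitely often, so one member answers all its questions. Minimization collects its finitely many
    subcomputations one by one. *)
Lemma ev_cont (A : nat -> Prop) (O : nat -> nat -> nat -> Prop) p :
  (exists q, A q) ->
  (forall q q', A q -> A q' -> exists r, A r /\ (forall x b, O q x b -> O r x b) /\
     (forall x b, O q' x b -> O r x b)) ->
  forall x y, ev (fun x b => exists q, A q /\ O q x b) p x y -> exists q, A q /\ ev (O q) p x y.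
Proof.
  intros (q0 & Hq0) Hdir. induction p; simpl; intros x y H; eauto.
  - destruct H as (u & v & Hu & Hv & ->).
    destruct (IHp1 _ _ Hu) as (q & Hq & Eq), (IHp2 _ _ Hv) as (q' & Hq' & Eq').
    destruct (Hdir q q' Hq Hq') as (r & Hr & L & L').
    exists r. split; [exact Hr|]. exists u, v. eauto using ev_mono.
  - destruct H as (u & Hu & Hy).
    destruct (IHp2 _ _ Hu) as (q & Hq & Eq), (IHp1 _ _ Hy) as (q' & Hq' & Eq').
    destruct (Hdir q q' Hq Hq') as (r & Hr & L & L').
    exists r. split; [exact Hr|]. exists u. eauto using ev_mono.
  - destruct H as [H0 H].
    assert (K : forall n, n <= y -> exists q, A q /\
      forall z, z < n -> exists w, ev (O q) p (cpair x z) (w + 1)).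
    { induction n as [|n IH]; intros Hn; [exists q0; split; [exact Hq0|lia]|].
      destruct IH as (q & Hq & Kq); [lia|].
      destruct (H n ltac:(lia)) as (w & Hw). destruct (IHp _ _ Hw) as (q' & Hq' & Eq').
      destruct (Hdir q q' Hq Hq') as (r & Hr & L & L').
      exists r. split; [exact Hr|]. intros z Hz. destruct (Nat.eq_dec z n) as [->|].
      - eauto using ev_mono.
      - destruct (Kq z ltac:(lia)) as (w' & Hw'). eauto using ev_mono. }
    destruct (K y (le_n y)) as (q & Hq & Kq), (IHp _ _ H0) as (q' & Hq' & Eq').
    destruct (Hdir q q' Hq Hq') as (r & Hr & L & L').
    exists r. split; [exact Hr|]. split; [eauto using ev_mono|].
    intros z Hz. destruct (Kq z Hz) as (w & Hw). eauto using ev_mono.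
Qed.

(** [ev] is positive in its oracle, since minimization asks for nonzero values instead of denying
    zeros. *)
Lemma sig_ev Y (O : nat -> nat -> nat -> Prop) p :
  Sig3 Y O -> Sig3 Y (fun q x y => ev (O q) p x y).
Proof.
  intros HO. induction p; simpl; sig.
Qed.

Lemma sig_oset Y : Sig2 Y (oset Y).
Proof. unfold oset. sig. Qed.

Lemma sig_ev_oset Y p : Sig2 Y (ev (oset Y) p).
Proof.
  pose proof (sig_oset Y) as H.
  assert (H3 : Sig3 Y (fun _ x b => oset Y x b)) by sig.
  apply (sig_use3 _ _ (fun _ => 0) (fun v => v 0) (fun v => v 1) (sig_ev _ _ p H3)); pol.
Qed.

(** ** Bounded relations are decided by programs *)

Fixpoint enc (k : nat) (v : env) : nat :=
  match k with O => 0 | S k => cpair (v 0) (enc k (sh v)) end.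

Section Compile.
Variable Y : nat -> Prop.

(** A program sees only a prefix of the environment, of length [k]. All lengths from [k0] on are
    allowed, so that two terms can share a prefix and a binder can lengthen it. *)
Definition Comp (t : env -> nat) : Prop :=
  exists k0, forall k, k0 <= k -> exists p, forall v, ev (oset Y) p (enc k v) (t v).

Lemma comp_map1 f t : (exists p, forall x, ev (oset Y) p x (f x)) -> Comp t ->
  Comp (fun v => f (t v)).
Proof.
  intros (p & Hp) (k0 & Ht). exists k0. intros k Hk. destruct (Ht k Hk) as (q & Hq).
  exists (PComp p q). intros v. exists (t v). auto.
Qed.

Lemma comp_map2 f t u : (exists p, forall x y, ev (oset Y) p (cpair x y) (f x y)) ->
  Comp t -> Comp u -> Comp (fun v => f (t v) (u v)).
Proof.
  intros (p & Hp) (k0 & Ht) (k1 & Hu). exists (k0 + k1). intros k Hk.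
  destruct (Ht k ltac:(lia)) as (q & Hq), (Hu k ltac:(lia)) as (q' & Hq').
  exists (PComp p (PPair q q')). intros v. exists (cpair (t v) (u v)).
  split; [exists (t v), (u v); auto|apply Hp].
Qed.

Lemma comp_pol t : Pol t -> Comp t.
Proof.
  induction 1.
  - exists (S i). intros k Hk. revert i Hk. induction k as [|k IH]; intros i Hk; [lia|].
    destruct i as [|i].
    + exists PFst. intros v. simpl. eauto.
    + destruct (IH i ltac:(lia)) as (p & Hp). exists (PComp p PSnd). intros v.
      simpl. exists (enc k (sh v)). split; [eauto|apply (Hp (sh v))].
  - exists 0. intros k _. exists (PConst c). reflexivity.
  - apply (comp_map2 Nat.add); [|assumption..]. exists PAdd. intros x y. simpl. eauto.
  - apply (comp_map2 Nat.mul); [|assumption..]. exists PMul. intros x y. simpl. eauto.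
Qed.

Definition ltn (x y : nat) : nat := if x <? y then 1 else 0.

Lemma ltn_0 x y : ltn x y = 0 <-> y <= x.
Proof. unfold ltn. destruct (Nat.ltb_spec x y); lia. Qed.

Lemma comp_ltn t u : Comp t -> Comp u -> Comp (fun v => ltn (t v) (u v)).
Proof.
  apply comp_map2. exists PLt. intros x y. exists x, y. split; [reflexivity|].
  unfold ltn. destruct (Nat.ltb_spec x y); lia.
Qed.

Lemma comp_mul t u : Comp t -> Comp u -> Comp (fun v => t v * u v).
Proof. apply comp_map2. exists PMul. intros x y. simpl. eauto. Qed.

Lemma comp_add t u : Comp t -> Comp u -> Comp (fun v => t v + u v).
Proof. apply comp_map2. exists PAdd. intros x y. simpl. eauto. Qed.

Lemma comp_sh t : Comp t -> Comp (fun v => t (sh v)).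
Proof.
  intros (k0 & Ht). exists (S k0). intros [|k] Hk; [lia|].
  destruct (Ht k ltac:(lia)) as (p & Hp). exists (PComp p PSnd).
  intros v. simpl. exists (enc k (sh v)). split; [eauto|apply Hp].
Qed.

Lemma comp_scons t u : Comp t -> Comp u -> Comp (fun v => t (scons (u v) v)).
Proof.
  intros (k0 & Ht) (k1 & Hu). exists (k0 + k1). intros k Hk.
  destruct (Ht (S k) ltac:(lia)) as (p & Hp), (Hu k ltac:(lia)) as (q & Hq).
  exists (PComp p (PPair q PId)). intros v. exists (enc (S k) (scons (u v) v)).
  split; [|apply Hp]. exists (u v), (enc k v). split; [apply Hq|]. split; reflexivity.
Qed.

Lemma comp_mu t : Comp t -> (forall v, exists z, t (scons z v) = 0) ->
  exists h, Comp h /\ forall v, t (scons (h v) v) = 0 /\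
    forall z, z < h v -> t (scons z v) <> 0.
Proof.
  intros (k0 & Ht) Hz.
  assert (Hm : forall v, exists m, t (scons m v) = 0 /\ forall z, z < m -> t (scons z v) <> 0).
  { intros v. destruct (Hz v) as (z & E). apply (least_nat (fun z => t (scons z v) = 0) z E). }
  exists (fun v => proj1_sig (constructive_indefinite_description _ (Hm v))). split.
  - exists k0. intros k Hk. destruct (Ht (S k) ltac:(lia)) as (p & Hp).
    (* [PMu] appends the candidate to its argument, whereas [enc] has the newest variable first;
       hence the exchange. *)
    exists (PMu (PComp p (PPair PSnd PFst))). intros v.
    destruct (constructive_indefinite_description _ (Hm v)) as (m & Hm0 & Hm1). simpl proj1_sig.
    assert (K : forall z, ev (oset Y) (PComp p (PPair PSnd PFst)) (cpair (enc k v) z) (t (scons z v))).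
    { intros z. exists (enc (S k) (scons z v)). split; [|apply Hp].
      exists z, (enc k v). simpl. eauto. }
    split.
    + rewrite <- Hm0. apply K.
    + intros z Hzm. specialize (K z). specialize (Hm1 z Hzm).
      destruct (t (scons z v)) as [|w]; [lia|]. exists w. rewrite Nat.add_1_r. exact K.
  - intros v. destruct (constructive_indefinite_description _ (Hm v)) as (m & Hm'). exact Hm'.
Qed.

(** Zero stands for truth, since zeros are what minimization searches for. Conjunction becomes a
    sum, disjunction a product, and a bounded quantifier a search that is forced to stop at its
    bound. *)
Lemma comp_dl P : Dl Y P -> exists t, Comp t /\ forall v, t v = 0 <-> P v.
Proof.
  induction 1.
  - exists (fun v => ltn (t v) (u v) + ltn (u v) (t v)). apply comp_pol in H, H0. split.
    + apply comp_add; apply comp_ltn; assumption.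
    + intros v. rewrite Nat.eq_add_0, !ltn_0. lia.
  - exists (fun v => ltn (if excluded_middle_informative (Y (t v)) then 1 else 0) 1). split.
    + apply comp_ltn; [|apply comp_pol, pol_const].
      apply comp_map1 with (f := fun x => if excluded_middle_informative (Y x) then 1 else 0);
        [|apply comp_pol, H].
      exists POrc. intros x. unfold oset. simpl. destruct (excluded_middle_informative (Y x)); auto.
    + intros v. rewrite ltn_0. destruct (excluded_middle_informative (Y (t v)));
        split; (lia || tauto).
  - exists (fun v => if excluded_middle_informative (Y (t v)) then 1 else 0). split.
    + apply comp_map1 with (f := fun x => if excluded_middle_informative (Y x) then 1 else 0);
        [|apply comp_pol, H].
      exists POrc. intros x. unfold oset. simpl. destruct (excluded_middle_informative (Y x)); auto.
    + intros v. destruct (excluded_middle_informative (Y (t v))); split; (discriminate || tauto).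
  - destruct IHAr1 as (t & Ht & E), IHAr2 as (u & Hu & E').
    exists (fun v => t v + u v). split; [apply comp_add; assumption|].
    intros v. rewrite Nat.eq_add_0, E, E'. reflexivity.
  - destruct IHAr1 as (t & Ht & E), IHAr2 as (u & Hu & E').
    exists (fun v => t v * u v). split; [apply comp_mul; assumption|].
    intros v. rewrite Nat.eq_mul_0, E, E'. reflexivity.
  - destruct IHAr as (u & Hu & E). apply comp_pol in H.
    (* The second factor vanishes at [t v + 1], so the search always ends; a witness exists exactly
       if it ends at [t v] or before. *)
    destruct (comp_mu (fun v => u v * ltn (v 0) (t (sh v) + 1))) as (h & Hh & Hmin).
    + apply comp_mul; [exact Hu|]. apply comp_ltn; [apply comp_pol, pol_var|].
      apply comp_add; [apply comp_sh, H|apply comp_pol, pol_const].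
    + intros v. exists (t v + 1). change (u (scons (t v + 1) v) * ltn (t v + 1) (t v + 1) = 0).
      apply Nat.eq_mul_0. right. apply ltn_0. lia.
    + exists (fun v => ltn (t v) (h v)). split; [apply comp_ltn; assumption|].
      intros v. rewrite ltn_0. destruct (Hmin v) as [Hm0 Hm1].
      change (u (scons (h v) v) * ltn (h v) (t v + 1) = 0) in Hm0.
      change (forall z, z < h v -> u (scons z v) * ltn z (t v + 1) <> 0) in Hm1.
      apply Nat.eq_mul_0 in Hm0. rewrite ltn_0 in Hm0. split.
      * intros Hle. exists (h v). split; [exact Hle|]. apply E. lia.
      * intros (x & Hx & Px%E). destruct (Nat.lt_ge_cases x (h v)) as [L|L]; [|lia].
        destruct (Hm1 x L). now rewrite Px.
  - destruct IHAr as (u & Hu & E). apply comp_pol in H.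
    destruct (comp_mu (fun v => ltn (v 0) (t (sh v)) * ltn (u v) 1)) as (h & Hh & Hmin).
    + apply comp_mul; (apply comp_ltn; [|]);
        [apply comp_pol, pol_var|apply comp_sh, H|exact Hu|apply comp_pol, pol_const].
    + intros v. exists (t v). change (ltn (t v) (t v) * ltn (u (scons (t v) v)) 1 = 0).
      apply Nat.eq_mul_0. left. apply ltn_0. lia.
    + exists (fun v => ltn (h v) (t v)). split; [apply comp_ltn; assumption|].
      intros v. rewrite ltn_0. destruct (Hmin v) as [Hm0 Hm1].
      change (ltn (h v) (t v) * ltn (u (scons (h v) v)) 1 = 0) in Hm0.
      change (forall z, z < h v -> ltn z (t v) * ltn (u (scons z v)) 1 <> 0) in Hm1.
      apply Nat.eq_mul_0 in Hm0. rewrite !ltn_0 in Hm0. split.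
      * intros Hle x Hx. apply E. specialize (Hm1 x ltac:(lia)).
        rewrite Nat.eq_mul_0, !ltn_0 in Hm1. lia.
      * intros K. destruct (Nat.lt_ge_cases (h v) (t v)) as [L|L]; [|exact L].
        specialize (K _ L). apply E in K. lia.
  - contradiction.
  - destruct IHAr as (t & Ht & E). exists t. split; [exact Ht|]. intros v. now rewrite E.
Qed.

End Compile.

(** ** Relative computability of sets *)

Definition Delta (Y X : nat -> Prop) : Prop := Sig1 Y X /\ Sig1 Y (fun x => ~ X x).

Definition reduces (p : prog) (Y X : nat -> Prop) : Prop :=
  forall x b, oset X x b -> ev (oset Y) p x b.

Lemma delta_of_reduces Y X p : reduces p Y X -> Delta Y X.
Proof.
  intros H. pose proof (sig_ev_oset Y p) as Hp.
  assert (F : forall x b, ev (oset Y) p x b -> oset X x b).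
  { intros x b Hb. destruct (classic (X x)) as [Hx|Hx].
    - assert (K : oset X x 1) by (left; auto).
      rewrite (ev_functional _ p (oset_functional Y) _ _ _ Hb (H _ _ K)). exact K.
    - assert (K : oset X x 0) by (right; auto).
      rewrite (ev_functional _ p (oset_functional Y) _ _ _ Hb (H _ _ K)). exact K. }
  split.
  - eapply ar_ext with (P := fun v => ev (oset Y) p (v 0) 1); [|sig].
    intros v. split; [intros [[]|[]]%F; (assumption || lia)|intros Hx; apply H; left; auto].
  - eapply ar_ext with (P := fun v => ev (oset Y) p (v 0) 0); [|sig].
    intros v. split; [intros [[]|[]]%F; (assumption || lia)|intros Hx; apply H; right; auto].
Qed.

(** Post's theorem. Search for a bound at which the normal form of [X] or that of its complement
    holds, then test the former at that bound. *)
Lemma reduces_of_delta Y X : Delta Y X -> exists p, reduces p Y X.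
Proof.
  intros [H1 H0].
  apply normal_form in H1 as (Q1 & D1 & _ & E1), H0 as (Q0 & D0 & _ & E0).
  apply comp_dl in D1 as (t1 & C1 & F1), D0 as (t0 & C0 & F0).
  destruct (comp_mu Y (fun v => t1 v * t0 v)) as (h & Hh & Hmin).
  { apply comp_mul; assumption. }
  { intros v. destruct (classic (X (v 0))) as [Hx|Hx].
    - apply E1 in Hx as (w & Hw%F1). exists w. now rewrite Hw.
    - apply E0 in Hx as (w & Hw%F0). exists w. rewrite Hw. lia. }
  assert (HC : Comp Y (fun v => ltn (t1 (scons (h v) v)) 1)).
  { apply comp_ltn; [apply comp_scons; assumption|apply comp_pol, pol_const]. }
  destruct HC as (k & HC). destruct (HC (S k) ltac:(lia)) as (p & Hp).
  exists (PComp p (PPair PId (PConst (enc k (fun _ => 0))))). intros x b Hb.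
  exists (enc (S k) (scons x (fun _ => 0))). split; [exists x, (enc k (fun _ => 0)); simpl; auto|].
  specialize (Hp (scons x (fun _ => 0))). specialize (Hmin (scons x (fun _ => 0))).
  set (v := scons x (fun _ => 0)) in *. destruct Hmin as [Hm _].
  replace b with (ltn (t1 (scons (h v) v)) 1); [exact Hp|].
  apply Nat.eq_mul_0 in Hm. rewrite F1, F0 in Hm.
  assert (Hv : v 0 = x) by reflexivity. clearbody v. subst x.
  destruct Hb as [[Hx ->]|[Hx ->]].
  - destruct Hm as [Hm|Hm]; [|destruct (proj2 (E0 v) (ex_intro _ _ Hm) Hx)].
    apply F1 in Hm. rewrite Hm. reflexivity.
  - apply ltn_0. destruct Hm as [Hm|Hm]; [destruct (Hx (proj2 (E1 v) (ex_intro _ _ Hm)))|].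
    destruct (t1 (scons (h v) v)) eqn:E; [|lia].
    apply F1 in E. destruct (Hx (proj2 (E1 v) (ex_intro _ _ E))).
Qed.

Lemma sig_trans Z Y P : Delta Y Z -> Sig Z P -> Sig Y P.
Proof.
  intros [H1 H0]. induction 1.
  - apply ar_eq; assumption.
  - apply (sig_use1 _ _ _ H1 H).
  - apply (sig_use1 _ _ _ H0 H).
  - apply ar_and; assumption.
  - apply ar_or; assumption.
  - apply ar_bex; assumption.
  - apply ar_ball; assumption.
  - apply ar_ex; assumption.
  - eapply ar_ext; eassumption.
Qed.

Lemma delta_trans Z Y X : Delta Y Z -> Delta Z X -> Delta Y X.
Proof. intros H [H1 H0]. split; eapply sig_trans; eassumption. Qed.

Lemma delta_refl Y : Delta Y Y.
Proof. split; sig. Qed.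

(** ** Programs and coded computations *)

Fixpoint pcode (p : prog) : nat :=
  match p with
  | PConst a => ix 0 a 0
  | PId => ix 1 0 0
  | PFst => ix 2 0 0
  | PSnd => ix 3 0 0
  | POrc => ix 4 0 0
  | PAdd => ix 5 0 0
  | PMul => ix 6 0 0
  | PLt => ix 7 0 0
  | PPair p q => ix 8 (pcode p) (pcode q)
  | PComp p q => ix 9 (pcode p) (pcode q)
  | PMu p => ix 10 (pcode p) 0
  end.

Lemma ix_inj t a b t' a' b' : ix t a b = ix t' a' b' -> t = t' /\ a = a' /\ b = b'.
Proof. unfold ix. intros [-> E]%cpair_inj. apply cpair_inj in E. tauto. Qed.

(** This makes induction on indices possible for the clauses that refer to other indices, whose tags
    are 8, 9 and 10. Tag 0 has to be excluded: [ix 0 0 0] is 0. *)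
Lemma ix_lt t a b : 0 < t -> a < ix t a b /\ b < ix t a b.
Proof.
  intros Ht. unfold ix. destruct (cpair_le a b). unfold cpair at 1 3.
  generalize dependent (cpair a b). intros c. nia.
Qed.

Lemma pcode_inj p q : pcode p = pcode q -> p = q.
Proof.
  revert q. induction p; intros [| | | | | | | | | |]; cbn [pcode]; intros E;
    apply ix_inj in E as (Et & Ea & Eb); try discriminate Et;
    repeat match goal with IH : forall q, pcode ?p = pcode q -> _, H : pcode ?p = _ |- _ =>
      apply IH in H end; congruence.
Qed.

Lemma justified_mono (F F' : nat -> nat -> nat -> Prop) Y e x y :
  (forall e x y, F e x y -> F' e x y) -> justified F Y e x y -> justified F' Y e x y.
Proof.
  intros HF. unfold justified.
  intros [H|[H|[H|[H|[H|[H|[H|[H|[H|[H|H]]]]]]]]]]; try tauto.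
  - do 8 right. left. destruct H as (a & b & E & u & v & H1 & H2 & H3).
    exists a, b. split; [exact E|]. exists u, v. auto.
  - do 9 right. left. destruct H as (a & b & E & u & H1 & H2).
    exists a, b. split; [exact E|]. exists u. auto.
  - do 10 right. destruct H as (a & E & H1 & H2).
    exists a. split; [exact E|]. split; [auto|]. intros z Hz. destruct (H2 z Hz). eauto.
Qed.

Lemma value_ev Y e x y : value Y e x y -> exists p, pcode p = e /\ ev (oset Y) p x y.
Proof.
  intros (D & HD & H). revert x y H.
  induction e as [e IH] using lt_wf_ind. intros x y H. apply HD in H.
  destruct H as [H|[H|[H|[H|[H|[H|[H|[H|[H|[H|H]]]]]]]]]].
  - destruct H as (a & -> & ->). exists (PConst a). split; reflexivity.
  - destruct H as (-> & ->). exists PId. split; reflexivity.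
  - destruct H as (-> & H). exists PFst. split; [reflexivity|exact H].
  - destruct H as (-> & H). exists PSnd. split; [reflexivity|exact H].
  - destruct H as (-> & H). exists POrc. split; [reflexivity|exact H].
  - destruct H as (-> & H). exists PAdd. split; [reflexivity|exact H].
  - destruct H as (-> & H). exists PMul. split; [reflexivity|exact H].
  - destruct H as (-> & H). exists PLt. split; [reflexivity|exact H].
  - destruct H as (a & b & -> & u & v & Ha & Hb & ->).
    destruct (ix_lt 8 a b ltac:(lia)) as [La Lb].
    apply (IH _ La) in Ha as (p & <- & Hp). apply (IH _ Lb) in Hb as (q & <- & Hq).
    exists (PPair p q). split; [reflexivity|]. exists u, v. auto.
  - destruct H as (a & b & -> & u & Hb & Ha).
    destruct (ix_lt 9 a b ltac:(lia)) as [La Lb].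
    apply (IH _ La) in Ha as (p & <- & Hp). apply (IH _ Lb) in Hb as (q & <- & Hq).
    exists (PComp p q). split; [reflexivity|]. exists u. auto.
  - destruct H as (a & -> & Ha & Hz).
    destruct (ix_lt 10 a 0 ltac:(lia)) as [La _].
    apply (IH _ La) in Ha as (p & <- & Hp). exists (PMu p). split; [reflexivity|].
    split; [exact Hp|]. intros z Lz. destruct (Hz z Lz) as (w & Hw).
    (* The induction hypothesis may give a different program for every [z]; all have the code of
       [p], hence equal [p]. *)
    apply (IH _ La) in Hw as (q & Eq & Hq). apply pcode_inj in Eq as ->. eauto.
Qed.

(** Computations are kept as bounded predicates, for which unions are immediate; the bound allows
    [setcode_exists] to code the final one. *)
Definition closed_facts (Y : nat -> Prop) (F : nat -> Prop) : Prop :=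
  (exists n, forall z, F z -> z < n) /\
  forall e x y, F (cpair e (cpair x y)) ->
    justified (fun e x y => F (cpair e (cpair x y))) Y e x y.

Lemma closed_empty Y : closed_facts Y (fun _ => False).
Proof. split; [exists 0; tauto|tauto]. Qed.

Lemma closed_union Y F G : closed_facts Y F -> closed_facts Y G ->
  closed_facts Y (fun z => F z \/ G z).
Proof.
  intros [(n & Hn) HF] [(m & Hm) HG]. split.
  - exists (n + m). intros z [Hz|Hz]; [apply Hn in Hz|apply Hm in Hz]; lia.
  - intros e x y [H|H]; [apply HF in H|apply HG in H];
      (eapply justified_mono; [|exact H]; simpl; auto).
Qed.

Lemma closed_add Y F e x y : closed_facts Y F ->
  justified (fun e x y => F (cpair e (cpair x y))) Y e x y ->
  closed_facts Y (fun z => F z \/ z = cpair e (cpair x y)).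
Proof.
  intros [(n & Hn) HF] HJ. split.
  - exists (n + S (cpair e (cpair x y))). intros z [Hz| ->]; [apply Hn in Hz|]; lia.
  - intros e' x' y' [H|H].
    + apply HF in H. eapply justified_mono; [|exact H]. simpl. auto.
    + apply cpair_inj in H as [-> H]. apply cpair_inj in H as [-> ->].
      eapply justified_mono; [|exact HJ]. simpl. auto.
Qed.

Lemma ev_closed Y p : forall x y, ev (oset Y) p x y ->
  exists F, closed_facts Y F /\ F (cpair (pcode p) (cpair x y)).
Proof.
  assert (Base : forall e x y,
    justified (fun e x y => False) Y e x y ->
    exists F, closed_facts Y F /\ F (cpair e (cpair x y))).
  { intros e x y HJ. exists (fun z => False \/ z = cpair e (cpair x y)).
    split; [|auto]. apply closed_add; [apply closed_empty|exact HJ]. }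
  induction p; intros x y H; cbn [pcode].
  - apply Base. left. exists a. auto.
  - apply Base. do 1 right. left. auto.
  - apply Base. do 2 right. left. auto.
  - apply Base. do 3 right. left. auto.
  - apply Base. do 4 right. left. auto.
  - apply Base. do 5 right. left. auto.
  - apply Base. do 6 right. left. auto.
  - apply Base. do 7 right. left. auto.
  - destruct H as (u & v & Hu & Hv & ->).
    destruct (IHp1 _ _ Hu) as (F & HF & Fu), (IHp2 _ _ Hv) as (G & HG & Gv).
    eexists. split; [apply (closed_add _ _ (ix 8 (pcode p1) (pcode p2)) x (cpair u v) (closed_union _ _ _ HF HG))|right; reflexivity].
    do 8 right. left. exists (pcode p1), (pcode p2). split; [reflexivity|].
    exists u, v. auto.
  - destruct H as (u & Hu & Hy).
    destruct (IHp2 _ _ Hu) as (F & HF & Fu), (IHp1 _ _ Hy) as (G & HG & Gv).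
    eexists. split; [apply (closed_add _ _ (ix 9 (pcode p1) (pcode p2)) x y (closed_union _ _ _ HF HG))|right; reflexivity].
    do 9 right. left. exists (pcode p1), (pcode p2). split; [reflexivity|].
    exists u. auto.
  - destruct H as [H0 H].
    assert (K : forall n, n <= y -> exists F, closed_facts Y F /\ forall z, z < n ->
      exists w, F (cpair (pcode p) (cpair (cpair x z) (w + 1)))).
    { induction n as [|n IH]; intros Hn; [exists (fun _ => False); split; [apply closed_empty|lia]|].
      destruct (IH ltac:(lia)) as (F & HF & KF). destruct (H n ltac:(lia)) as (w & Hw).
      destruct (IHp _ _ Hw) as (G & HG & Gw).
      eexists. split; [apply (closed_union _ _ _ HF HG)|].
      intros z Hz. destruct (Nat.eq_dec z n) as [->|]; [eauto|].
      destruct (KF z ltac:(lia)); eauto. }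
    destruct (K y (le_n y)) as (F & HF & KF), (IHp _ _ H0) as (G & HG & G0).
    eexists. split; [apply (closed_add _ _ (ix 10 (pcode p) 0) x y (closed_union _ _ _ HF HG))|right; reflexivity].
    do 10 right. exists (pcode p). split; [reflexivity|]. split; [auto|].
    intros z Hz. destruct (KF z Hz). eauto.
Qed.

Lemma ev_value Y p x y : ev (oset Y) p x y -> value Y (pcode p) x y.
Proof.
  intros H. destruct (ev_closed Y p x y H) as (F & [(n & Hn) HF] & Fp).
  destruct (setcode_exists F n) as (D & _ & HD).
  assert (E : forall z, el z D <-> F z) by (intros z; rewrite HD; split; [tauto|auto]).
  exists D. split; [|apply E, Fp].
  intros e x' y' K. apply E in K. apply HF in K.
  eapply justified_mono; [|exact K]. intros. apply E. assumption.
Qed.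

Lemma turing_le_reduces X Y : turing_le X Y <-> exists p, reduces p Y X.
Proof.
  split.
  - intros (e & He).
    (* A number [e] need not be the code of a program, but here it is, because it has a value at
       0. *)
    assert (Hp : exists p, pcode p = e).
    { destruct (He 0) as [[_ H]|[_ H]]; apply value_ev in H as (p & Hp & _); eauto. }
    destruct Hp as (p & <-). exists p.
    intros x b Hb. destruct (He x) as [[Hx H]|[Hx H]]; apply value_ev in H as (q & Eq & Hq);
      apply pcode_inj in Eq as ->; destruct Hb as [[] | []]; subst; tauto.
  - intros (p & Hp). exists (pcode p). intros x.
    destruct (classic (X x)) as [Hx|Hx]; [left|right]; (split; [exact Hx|]);
      apply ev_value, Hp; [left|right]; auto.
Qed.

Lemma turing_le_delta X Y : turing_le X Y <-> Delta Y X.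
Proof.
  rewrite turing_le_reduces. split; [intros (p & Hp)|apply reduces_of_delta].
  apply (delta_of_reduces _ _ _ Hp).
Qed.

Lemma sig_value Y Z : Delta Y Z -> Sig3 Y (value Z).
Proof.
  intros [H1 H0].
  eapply ar_ext with (P := fun v => exists D, fact D (v 0) (v 1) (v 2) /\
    forall e, e < D -> forall x, x < D -> forall y, y < D ->
      ~ fact D e x y \/ justified (fact D) Z e x y).
  - intros v. unfold value, computation. split; intros (D & H); exists D.
    + split; [|tauto]. intros e x y K. destruct H as [_ H].
      pose proof (el_lt _ _ K).
      destruct (cpair_le e (cpair x y)), (cpair_le x y).
      destruct (H e ltac:(lia) x ltac:(lia) y ltac:(lia)); tauto.
    + split; [tauto|]. intros e _ x _ y _. destruct (classic (fact D e x y)); [right; apply H|]; auto.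
  - unfold justified. sig.
Qed.

Lemma reduces_iff p Y X : reduces p Y X -> forall x b, ev (oset Y) p x b <-> oset X x b.
Proof.
  intros H x b. split; [|apply H]. intros Hb.
  assert (K : exists b', oset X x b').
  { destruct (classic (X x)); [exists 1; left|exists 0; right]; auto. }
  destruct K as (b' & K).
  rewrite (ev_functional _ p (oset_functional Y) _ _ _ Hb (H _ _ K)). exact K.
Qed.

(** * Cohen conditions *)

(* Every number is a condition: [cpair l D] decides the numbers below [l]
   according to the finite set coded by [D], other numbers decide nothing. *)
Definition cin (q i b : nat) : Prop :=
  exists l D, q = cpair l D /\ i < l /\ ((el i D /\ b = 1) \/ (~ el i D /\ b = 0)).
Definition cle (q r : nat) : Prop := forall i b, cin q i b -> cin r i b.
Definition csub (q : nat) (G : nat -> Prop) : Prop := forall i b, cin q i b -> oset G i b.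

Lemma cle_refl q : cle q q.
Proof. intros i b H. exact H. Qed.

Lemma cle_trans q r s : cle q r -> cle r s -> cle q s.
Proof. intros H K i b L. apply K, H, L. Qed.

Lemma cin_functional q : functional (cin q).
Proof.
  intros i b b' (l & D & -> & _ & H) (l' & D' & E & _ & H'). apply cpair_inj in E as [-> ->].
  destruct H as [[] | []], H' as [[] | []]; subst; tauto.
Qed.

Lemma cin_bound q i b : cin q i b -> i < q /\ b < 2.
Proof.
  intros (l & D & -> & Hi & H). destruct (cpair_le l D). lia.
Qed.

Lemma sig_cin Y : Sig3 Y cin.
Proof. unfold cin. sig. Qed.

Lemma sig_ncin Y : Sig3 Y (fun q i b => ~ cin q i b).
Proof.
  eapply ar_ext with (P := fun v => forall l, l < S (v 0) -> forall D, D < S (v 0) ->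
    v 0 <> cpair l D \/ ~ v 1 < l \/ ((~ el (v 1) D \/ v 2 <> 1) /\ (el (v 1) D \/ v 2 <> 0))).
  - intros v. split.
    + intros H (l & D & E & Hi & K). destruct (cpair_le l D).
      destruct (H l ltac:(lia) D ltac:(lia)); tauto.
    + intros H l _ D _. apply NNPP. intros N. apply H. exists l, D.
      destruct (Nat.eq_dec (v 0) (cpair l D)); [|tauto]. split; [assumption|].
      destruct (classic (v 1 < l)); [|tauto]. split; [assumption|].
      apply NNPP. tauto.
  - sig.
Qed.

Lemma sig_cle Y : Sig2 Y cle.
Proof.
  pose proof (sig_cin Y) as H1. pose proof (sig_ncin Y) as H2.
  eapply ar_ext with (P := fun v => forall i, i < v 0 -> forall b, b < 2 ->
    ~ cin (v 0) i b \/ cin (v 1) i b); [|sig].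
  intros v. split.
  - intros H i b K. destruct (cin_bound _ _ _ K). destruct (H i ltac:(auto) b); tauto.
  - intros H i _ b _. destruct (classic (cin (v 0) i b)); auto.
Qed.

Lemma sig_ncle Y : Sig2 Y (fun q r => ~ cle q r).
Proof.
  pose proof (sig_cin Y) as H1. pose proof (sig_ncin Y) as H2.
  eapply ar_ext with (P := fun v => exists i b, cin (v 0) i b /\ ~ cin (v 1) i b); [|sig].
  intros v. split.
  - intros (i & b & K & N) H. apply N, H, K.
  - intros H. apply NNPP. intros N. apply H. intros i b K. apply NNPP. intros M. apply N. eauto.
Qed.

(** The code of a condition can be enlarged at will while extending it. Sizes of codes later count
    the levels of the perfect tree. *)
Lemma cond_longer q n : exists r, cle q r /\ n < r.
Proof.
  destruct (classic (exists l D, q = cpair l D)) as [(l & D & ->)|N].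
  - exists (cpair (l + S n) D). split; [|destruct (cpair_le (l + S n) D); lia].
    intros i b (l' & D' & E & Hi & H). apply cpair_inj in E as [<- <-].
    exists (l + S n), D. split; [reflexivity|]. split; [lia|exact H].
  - exists (cpair (S n) 0). split; [|destruct (cpair_le (S n) 0); lia].
    intros i b (l & D & E & _). destruct N. eauto.
Qed.

Lemma cond_bit q : exists i, forall b, b < 2 -> exists r, cle q r /\ cin r i b.
Proof.
  assert (K : exists l D, forall i b, cin q i b -> cin (cpair l D) i b).
  { destruct (classic (exists l D, q = cpair l D)) as [(l & D & ->)|N]; [eauto|].
    exists 0, 0. intros i b (l & D & E & _). destruct N. eauto. }
  destruct K as (l & D & K). exists l. intros b Hb.
  destruct (setcode_exists (fun i => (i < l /\ el i D) \/ (i = l /\ b = 1)) (S l)) as (D' & _ & HD).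
  exists (cpair (S l) D'). split.
  - intros i c H%K. destruct H as (l' & D0 & E & Hi & Hc). apply cpair_inj in E as [<- <-].
    exists (S l), D'. split; [reflexivity|]. split; [lia|]. rewrite HD.
    assert (i <> l) by lia. assert (i < S l) by lia. tauto.
  - exists (S l), D'. split; [reflexivity|]. split; [lia|]. rewrite HD.
    assert (l < S l) by lia. assert (~ l < l) by lia.
    destruct (Nat.eq_dec b 1); [left|right; assert (b = 0) by lia]; tauto.
Qed.

Lemma cond_initial (G : nat -> Prop) n :
  exists q, csub q G /\ forall i b, i < n -> oset G i b -> cin q i b.
Proof.
  destruct (setcode_exists G n) as (D & _ & HD). exists (cpair n D). split.
  - intros i b (l & D' & E & Hi & H). apply cpair_inj in E as [<- <-].
    rewrite HD in H. unfold oset. tauto.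
  - intros i b Hi H. exists n, D. split; [reflexivity|]. split; [exact Hi|].
    rewrite HD. unfold oset in H. tauto.
Qed.

Lemma cond_directed G q q' : csub q G -> csub q' G ->
  exists r, csub r G /\ cle q r /\ cle q' r.
Proof.
  intros H H'. destruct (cond_initial G (q + q')) as (r & Hr & K). exists r.
  split; [exact Hr|]. split; intros i b Hi; apply K.
  - apply cin_bound in Hi. lia.
  - apply H, Hi.
  - apply cin_bound in Hi. lia.
  - apply H', Hi.
Qed.

Definition decides (G : nat -> Prop) (U : nat -> Prop) : Prop :=
  exists q, csub q G /\ (U q \/ forall r, cle q r -> ~ U r).

Lemma generic_exists (U : nat -> nat -> Prop) : exists G, forall n, decides G (U n).
Proof.
  assert (H : forall n q, exists r, cle q r /\ (U n r \/ forall s, cle r s -> ~ U n s)).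
  { intros n q. destruct (classic (exists r, cle q r /\ U n r)) as [(r & Hr & K)|N]; [eauto|].
    exists q. split; [apply cle_refl|]. right. intros s Hs K. apply N. eauto. }
  set (step := fun n q => proj1_sig (constructive_indefinite_description _ (H n q))).
  assert (Hstep : forall n q, cle q (step n q) /\
    (U n (step n q) \/ forall s, cle (step n q) s -> ~ U n s)).
  { intros n q. unfold step.
    destruct (constructive_indefinite_description _ (H n q)) as (r & Hr). exact Hr. }
  clearbody step.
  set (c := nat_rec (fun _ => nat) 0 step).
  assert (Hc : forall n m, n <= m -> cle (c n) (c m)).
  { induction 1; [apply cle_refl|]. eapply cle_trans; [exact IHle|apply (Hstep m (c m))]. }
  set (G := fun i => exists n, cin (c n) i 1).
  assert (HG : forall n, csub (c n) G).
  { intros n i b Hi. destruct (cin_bound _ _ _ Hi) as [_ Hb].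
    destruct (Nat.eq_dec b 1) as [->|]; [left; split; [exists n; exact Hi|reflexivity]|].
    right. split; [|lia]. intros (m & Hm). assert (b = 0) as -> by lia.
    apply (Hc n (n + m)) in Hi; [|lia]. apply (Hc m (n + m)) in Hm; [|lia].
    discriminate (cin_functional _ _ _ _ Hi Hm). }
  exists G. intros n. exists (c (S n)). split; [apply HG|]. apply (Hstep n (c n)).
Qed.

(** * Joins, and the part of a join decided by a condition *)

Definition join (Y G : nat -> Prop) (x : nat) : Prop :=
  (exists i, x = i + i /\ Y i) \/ (exists i, x = i + i + 1 /\ G i).
(** What is known of the oracle [join Y G] when [G] extends [q]. It is partial, and semi-decidable
    in [Y] uniformly in [q]. *)
Definition jo (Y : nat -> Prop) (q x b : nat) : Prop :=
  (exists i, x = i + i /\ oset Y i b) \/ (exists i, x = i + i + 1 /\ cin q i b).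

Lemma join_even Y G i : join Y G (i + i) <-> Y i.
Proof.
  split; [|intros H; left; eauto].
  intros [(j & E & H)|(j & E & H)]; [|lia]. assert (i = j) as -> by lia. exact H.
Qed.

Lemma join_odd Y G i : join Y G (i + i + 1) <-> G i.
Proof.
  split; [|intros H; right; eauto].
  intros [(j & E & H)|(j & E & H)]; [lia|]. assert (i = j) as -> by lia. exact H.
Qed.

Lemma delta_join_l Y G : Delta (join Y G) Y.
Proof.
  split.
  - eapply ar_ext with (P := fun v => join Y G (v 0 + v 0)); [intros v; apply join_even|sig].
  - eapply ar_ext with (P := fun v => ~ join Y G (v 0 + v 0)); [intros v; now rewrite join_even|sig].
Qed.

Lemma delta_join_r Y G : Delta (join Y G) G.
Proof.
  split.
  - eapply ar_ext with (P := fun v => join Y G (v 0 + v 0 + 1)); [intros v; apply join_odd|sig].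
  - eapply ar_ext with (P := fun v => ~ join Y G (v 0 + v 0 + 1)); [intros v; now rewrite join_odd|sig].
Qed.

Lemma jo_mono Y q r : cle q r -> forall x b, jo Y q x b -> jo Y r x b.
Proof. intros H x b [K|(i & E & K)]; [left; exact K|right; eauto]. Qed.

Lemma jo_functional Y q : functional (jo Y q).
Proof.
  intros x b b' [(i & E & H)|(i & E & H)] [(i' & E' & H')|(i' & E' & H')]; try lia;
    assert (i = i') as <- by lia.
  - apply (oset_functional _ _ _ _ H H').
  - apply (cin_functional _ _ _ _ H H').
Qed.

Lemma jo_join Y G q : csub q G -> forall x b, jo Y q x b -> oset (join Y G) x b.
Proof.
  intros H x b [(i & -> & K)|(i & -> & K%H)]; unfold oset in *.
  - rewrite join_even. exact K.
  - rewrite join_odd. exact K.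
Qed.

Lemma join_jo Y G x b : oset (join Y G) x b -> exists q, csub q G /\ jo Y q x b.
Proof.
  intros H.
  assert (E : (exists i, x = i + i) \/ (exists i, x = i + i + 1)).
  { destruct (Nat.Even_or_Odd x) as [(i & ->)|(i & ->)]; [left|right]; exists i; lia. }
  destruct E as [(i & ->)|(i & ->)].
  - destruct (cond_initial G 0) as (q & Hq & _). exists q. split; [exact Hq|].
    left. exists i. split; [reflexivity|]. unfold oset in *. rewrite join_even in H. exact H.
  - destruct (cond_initial G (S i)) as (q & Hq & K). exists q. split; [exact Hq|].
    right. exists i. split; [reflexivity|]. apply K; [lia|].
    unfold oset in *. rewrite join_odd in H. exact H.
Qed.

Lemma sig_jo Y : Sig3 Y (jo Y).
Proof.
  pose proof (sig_oset Y) as H1. pose proof (sig_cin Y) as H2. unfold jo. sig.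
Qed.

(** * The perfect tree of a forced name *)

(* [vname] is the partial characteristic function that the condition [q] forces
   on the set named by [phi], and [vfun] what [psi] computes from it. *)
Definition vname (Y : nat -> Prop) (phi : prog) (q x b : nat) : Prop := ev (jo Y q) phi x b.
Definition pname Y phi (q i v : nat) : Prop := vname Y phi q (cpair i v) 1.
Definition vfun Y phi psi (q j b : nat) : Prop := ev (vname Y phi q) psi j b.

(** The ways in which the name can fail: a value other than 0 and 1, an element that is no pair, two
    values at one argument, a finite part outside [T], a computation by [psi] that disagrees with
    [Z]. Each is caused by finitely many forced facts and so persists in extensions. *)
Definition wrong Y phi psi (T Z : nat -> Prop) (q : nat) : Prop :=
  (exists x b, vname Y phi q x b /\ b <> 0 /\ b <> 1) \/
  (exists x, vname Y phi q x 1 /\ forall i v, x <> cpair i v) \/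
  (exists i v w, v <> w /\ pname Y phi q i v /\ pname Y phi q i w) \/
  (exists s, isseq s /\ (forall i v, entry s i v -> pname Y phi q i v) /\ ~ T s) \/
  (exists j b, vfun Y phi psi q j b /\ ~ oset Z j b).

Definition splits Y phi (q : nat) : Prop :=
  exists r r' i v w, cle q r /\ cle q r' /\ v <> w /\ pname Y phi r i v /\ pname Y phi r' i w.

Section PerfectTree.
Variables (Y : nat -> Prop) (phi psi : prog) (T Z : nat -> Prop) (p : nat).
Let Ph := pname Y phi.
Let Ps := vfun Y phi psi.
Hypothesis Htot : forall q, cle p q -> forall i, exists r, cle q r /\ exists v, Ph r i v.
Hypothesis Hfun : forall q, cle p q -> forall j, exists r, cle q r /\ exists b, Ps r j b.
Hypothesis Hright : forall q, cle p q -> ~ wrong Y phi psi T Z q.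
Hypothesis Hsplit : forall q, cle p q -> splits Y phi q.

Lemma sig_vname : Sig3 Y (vname Y phi).
Proof. apply sig_ev, sig_jo. Qed.
Lemma sig_Ph : Sig3 Y Ph.
Proof. unfold Ph, pname. pose proof sig_vname. sig. Qed.
Lemma sig_Ps : Sig3 Y Ps.
Proof. apply sig_ev, sig_vname. Qed.

Lemma vname_mono q r x b : cle q r -> vname Y phi q x b -> vname Y phi r x b.
Proof. intros H. apply ev_mono, jo_mono, H. Qed.
Lemma Ph_mono q r i v : cle q r -> Ph q i v -> Ph r i v.
Proof. apply vname_mono. Qed.
Lemma Ps_mono q r j b : cle q r -> Ps q j b -> Ps r j b.
Proof. intros H. apply ev_mono. intros x c. apply vname_mono, H. Qed.
Lemma Ph_functional q i v w : cle p q -> Ph q i v -> Ph q i w -> v = w.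
Proof.
  intros Hq Hv Hw. apply NNPP. intros N. apply (Hright q Hq).
  right; right; left. exists i, v, w. auto.
Qed.

(** Codes serve as level counters: a child has a larger code than its parent and decides all
    arguments up to the parent's code. So a node at level [n] decides all arguments below [n]. *)
Definition step (q a : nat) : Prop :=
  cle q a /\ q < a /\ (forall i, i < S q -> exists v, Ph a i v) /\
  (forall j, j < S q -> exists b, Ps a j b).
(** The escape for conditions not extending [p] makes the relation total, as [selection] demands. *)
Definition branching (q z : nat) : Prop :=
  exists a b, z = cpair a b /\
    (~ cle p q \/ (step q a /\ step q b /\ exists i v w, v <> w /\ Ph a i v /\ Ph b i w)).

Lemma step_exists n q0 q : cle p q -> cle q0 q -> q0 <= n ->
  exists a, cle q a /\ step q0 a.
Proof.
  intros Hp H0 Hn.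
  assert (H1 : forall k, exists r, cle q r /\ forall i, i < k -> exists v, Ph r i v).
  { induction k as [|k (r & Hr & K)]; [exists q; split; [apply cle_refl|lia]|].
    destruct (Htot r (cle_trans _ _ _ Hp Hr) k) as (r' & Hr' & v & Hv).
    exists r'. split; [eapply cle_trans; eassumption|]. intros i Hi.
    destruct (Nat.eq_dec i k) as [->|]; [eauto|].
    destruct (K i ltac:(lia)) as (w & Hw). exists w. eapply Ph_mono; eassumption. }
  destruct (H1 (S q0)) as (r & Hr & K).
  assert (H2 : forall k, exists r', cle r r' /\ forall j, j < k -> exists b, Ps r' j b).
  { induction k as [|k (r' & Hr' & K')]; [exists r; split; [apply cle_refl|lia]|].
    destruct (Hfun r' (cle_trans _ _ _ Hp (cle_trans _ _ _ Hr Hr')) k) as (r'' & Hr'' & b & Hb).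
    exists r''. split; [eapply cle_trans; eassumption|]. intros j Hj.
    destruct (Nat.eq_dec j k) as [->|]; [eauto|].
    destruct (K' j ltac:(lia)) as (w & Hw). exists w. eapply Ps_mono; eassumption. }
  destruct (H2 (S q0)) as (r' & Hr' & K').
  destruct (cond_longer r' n) as (a & Ha & Hna).
  exists a. split; [eauto using cle_trans|]. split; [eauto using cle_trans|].
  split; [lia|]. split.
  - intros i Hi. destruct (K i Hi) as (v & Hv). exists v.
    eapply Ph_mono; [|exact Hv]. eauto using cle_trans.
  - intros j Hj. destruct (K' j Hj) as (b & Hb). exists b. eapply Ps_mono; eassumption.
Qed.

Lemma branching_exists q : exists z, branching q z.
Proof.
  destruct (classic (cle p q)) as [Hq|N]; [|exists (cpair 0 0), 0, 0; auto].
  destruct (Hsplit q Hq) as (r & r' & i & v & w & Hr & Hr' & N & Hv & Hw).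
  destruct (step_exists q q r) as (a & Ha & Sa); eauto using cle_trans.
  destruct (step_exists q q r') as (b & Hb & Sb); eauto using cle_trans.
  exists (cpair a b), a, b. split; [reflexivity|]. right. split; [exact Sa|]. split; [exact Sb|].
  exists i, v, w. split; [exact N|]. split; eapply Ph_mono; eassumption.
Qed.

Lemma sig_branching : Sig2 Y branching.
Proof.
  pose proof sig_Ph. pose proof sig_Ps. pose proof (sig_cle Y). pose proof (sig_ncle Y).
  unfold branching, step. sig.
Qed.

Lemma children_exist : exists F : bool -> nat -> nat,
  (forall q, cle p q -> step q (F false q) /\ step q (F true q) /\
     exists i v w, v <> w /\ Ph (F false q) i v /\ Ph (F true q) i w) /\
  forall c, Sig2 Y (fun q a => a = F c q).
Proof.
  destruct (selection Y branching sig_branching branching_exists) as (B & HB & SB).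
  destruct (selection Y (fun q a => exists z b, z = B q /\ z = cpair a b)) as (F0 & H0 & S0).
  { sig. }
  { intros q. destruct (HB q) as (a & b & E & _). exists a, (B q), b. auto. }
  destruct (selection Y (fun q b => exists z a, z = B q /\ z = cpair a b)) as (F1 & H1 & S1).
  { sig. }
  { intros q. destruct (HB q) as (a & b & E & _). exists b, (B q), a. auto. }
  exists (fun c => if c : bool then F1 else F0). split; [|intros []; assumption].
  intros q Hq. destruct (HB q) as (a & b & E & [N|H]); [tauto|].
  destruct (H0 q) as (z & b' & -> & E0). destruct (H1 q) as (z' & a' & -> & E1).
  rewrite E in E0, E1. apply cpair_inj in E0 as [<- _]. apply cpair_inj in E1 as [_ <-].
  exact H.
Qed.

(** The graph of [Nat.testbit] by division with remainder: [h] and [l] are the parts of [t] above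
    and below digit [n]. *)
Definition bit (t n c : nat) : Prop :=
  exists h l B, B = 2 ^ n /\ t = l + (c + 2 * h) * B /\ l < B.

Lemma bit_testbit t n c : bit t n (Nat.b2n c) <-> c = Nat.testbit t n.
Proof.
  split.
  - intros (h & l & B & -> & E & Hl). symmetry.
    apply (Nat.testbit_unique _ _ _ l h); assumption.
  - intros ->. destruct (Nat.testbit_spec t n) as (l & h & [_ Hl] & E).
    exists h, l, (2 ^ n). auto.
Qed.

Lemma sig_bit : Sig3 Y bit.
Proof. pose proof (sig_pow2 Y). unfold bit. sig. Qed.

(** * The nodes of the perfect tree and the sequences they force *)

Section Nodes.
Variable F : bool -> nat -> nat.
Hypothesis HF : forall q, cle p q -> step q (F false q) /\ step q (F true q) /\
   exists i v w, v <> w /\ Ph (F false q) i v /\ Ph (F true q) i w.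
Hypothesis SF : forall c, Sig2 Y (fun q a => a = F c q).

(* The node at level [n] along the branch given by the binary digits of [t]. *)
Definition node (t n : nat) : nat := prec p (fun t n q => F (Nat.testbit t n) q) t n.

Lemma sig_node : Sig3 Y (fun t n q => q = node t n).
Proof.
  apply sig_prec. pose proof (SF true) as S1. pose proof (SF false) as S0.
  pose proof sig_bit as Sb.
  eapply ar_ext with (P := fun v => (bit (v 0) (v 1) 1 /\ v 3 = F true (v 2)) \/
    (bit (v 0) (v 1) 0 /\ v 3 = F false (v 2))); [|sig].
  intros v. rewrite (bit_testbit _ _ true), (bit_testbit _ _ false).
  destruct (Nat.testbit (v 0) (v 1)); intuition discriminate.
Qed.

Lemma node_step t n : cle p (node t n) -> step (node t n) (node t (S n)).
Proof.
  intros H. change (node t (S n)) with (F (Nat.testbit t n) (node t n)).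
  destruct (HF _ H) as (H0 & H1 & _). destruct (Nat.testbit t n); assumption.
Qed.

Lemma node_cle t n : cle p (node t n).
Proof.
  induction n as [|n IH]; [apply cle_refl|].
  eapply cle_trans; [exact IH|apply node_step, IH].
Qed.

Lemma node_mono t n m : n <= m -> cle (node t n) (node t m).
Proof.
  induction 1; [apply cle_refl|].
  eapply cle_trans; [exact IHle|apply node_step, node_cle].
Qed.

Lemma node_ge t n : n <= node t n.
Proof.
  induction n as [|n IH]; [lia|].
  destruct (node_step t n (node_cle t n)) as (_ & H & _). lia.
Qed.

Lemma node_Ph t n i : i < n -> exists v, Ph (node t n) i v.
Proof.
  destruct n as [|n]; intros Hi; [lia|].
  destruct (node_step t n (node_cle t n)) as (_ & _ & H & _).
  pose proof (node_ge t n). apply H. lia.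
Qed.

Lemma node_Ps t n j : j < n -> exists b, Ps (node t n) j b.
Proof.
  destruct n as [|n]; intros Hi; [lia|].
  destruct (node_step t n (node_cle t n)) as (_ & _ & _ & H).
  pose proof (node_ge t n). apply H. lia.
Qed.

Lemma node_eq t t' n : (forall i, i < n -> Nat.testbit t i = Nat.testbit t' i) ->
  node t n = node t' n.
Proof.
  induction n as [|n IH]; intros H; [reflexivity|].
  change (F (Nat.testbit t n) (node t n) = F (Nat.testbit t' n) (node t' n)).
  rewrite IH, (H n); auto.
Qed.

(** Level [n] thus has at most [2 ^ n] nodes, and a search through it is a bounded quantifier. *)
Lemma node_mod t n : node (t mod 2 ^ n) n = node t n.
Proof. apply node_eq. intros i Hi. apply Nat.mod_pow2_bits_low, Hi. Qed.

Definition subtree (s : nat) : Prop :=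
  isseq s /\ exists t n, forall i v, entry s i v -> Ph (node t n) i v.

Lemma subtree_level s n : subtree s -> exists t, exists m, n <= m /\
  forall i v, entry s i v -> Ph (node t m) i v.
Proof.
  intros (_ & t & m & H). exists t, (n + m). split; [lia|].
  intros i v Hi. eapply Ph_mono; [|apply H, Hi]. apply node_mono. lia.
Qed.

(** Nodes of level [s] decide every index in the domain of [s], as these are below the code. Hence
    [s] is left out exactly if each node of this one level contradicts it, and that makes the
    complement semi-decidable. *)
Lemma not_subtree s : isseq s -> ~ subtree s <->
  forall t, t < 2 ^ s -> exists i v w, entry s i v /\ Ph (node t s) i w /\ v <> w.
Proof.
  intros Hs. split.
  - intros N t _. apply NNPP. intros K. apply N. split; [exact Hs|]. exists t, s.
    intros i v Hv. destruct (entry_lt _ _ _ Hv) as [Hi _].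
    destruct (node_Ph t s i Hi) as (w & Hw).
    destruct (Nat.eq_dec v w) as [->|]; [exact Hw|]. destruct K. eauto 6.
  - intros H K. apply (subtree_level s s) in K as (t & m & Hm & K).
    assert (Ht : t mod 2 ^ s < 2 ^ s) by (apply Nat.mod_upper_bound, Nat.pow_nonzero; lia).
    destruct (H _ Ht) as (i & v & w & Hv & Hw & N). rewrite node_mod in Hw.
    apply N, (Ph_functional (node t m) i); [apply node_cle|apply K, Hv|].
    eapply Ph_mono; [|exact Hw]. apply node_mono, Hm.
Qed.

Lemma delta_subtree : Delta Y subtree.
Proof.
  pose proof sig_Ph as S1. pose proof sig_node as S2. pose proof (sig_pow2 Y) as S3.
  pose proof (sig_isseq Y) as S4. pose proof (sig_nisseq Y) as S5.
  split.
  - eapply ar_ext with (P := fun u => isseq (u 0) /\ exists t n, forall i, i < u 0 ->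
      forall v, v < u 0 -> ~ entry (u 0) i v \/ exists q, q = node t n /\ Ph q i v); [|sig].
    intros u. unfold subtree. split; intros (Hs & t & n & H); (split; [exact Hs|]); exists t, n.
    + intros i v Hv. destruct (entry_lt _ _ _ Hv) as [Li Lv].
      destruct (H i Li v Lv) as [|(q & -> & K)]; [tauto|exact K].
    + intros i _ v _. destruct (classic (entry (u 0) i v)); [right; eauto|auto].
  - eapply ar_ext with (P := fun u => ~ isseq (u 0) \/ exists B, B = 2 ^ (u 0) /\
      forall t, t < B -> exists i v w, entry (u 0) i v /\
        (exists q, q = node t (u 0) /\ Ph q i w) /\ v <> w); [|sig].
    intros u. destruct (classic (isseq (u 0))) as [Hs|Hs].
    + rewrite not_subtree by exact Hs. split.
      * intros [N|(B & -> & H)]; [tauto|]. intros t Ht.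
        destruct (H t Ht) as (i & v & w & Hv & (q & -> & Hw) & N). eauto 6.
      * intros H. right. exists (2 ^ u 0). split; [reflexivity|]. intros t Ht.
        destruct (H t Ht) as (i & v & w & Hv & Hw & N). exists i, v, w. eauto 6.
    + unfold subtree. tauto.
Qed.

Lemma subtree_sub s : subtree s -> T s.
Proof.
  intros (Hs & t & n & H). apply NNPP. intros N. apply (Hright (node t n)); [apply node_cle|].
  right; right; right; left. exists s. auto.
Qed.

Lemma node_seq t n l : l <= n -> exists s, subtree s /\
  forall i v, entry s i v <-> i < l /\ Ph (node t n) i v.
Proof.
  intros Hl.
  assert (K : forall i, exists v, i < n -> Ph (node t n) i v).
  { intros i. destruct (Nat.lt_ge_cases i n) as [Hi|Hi].
    - destruct (node_Ph t n i Hi) as (v & Hv). eauto.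
    - exists 0. lia. }
  set (f := fun i => proj1_sig (constructive_indefinite_description _ (K i))).
  assert (Hf : forall i, i < n -> Ph (node t n) i (f i)).
  { intros i. unfold f. destruct (constructive_indefinite_description _ (K i)). assumption. }
  clearbody f.
  destruct (seq_exists f l) as (s & Hs & E).
  assert (E' : forall i v, entry s i v <-> i < l /\ Ph (node t n) i v).
  { intros i v. rewrite E. split.
    - intros [Hi ->]. split; [exact Hi|]. apply Hf. lia.
    - intros [Hi Hv]. split; [exact Hi|].
      apply (Ph_functional (node t n) i); [apply node_cle|exact Hv|apply Hf; lia]. }
  exists s. split; [|exact E']. split; [exact Hs|]. exists t, n. intros i v Hv. apply E', Hv.
Qed.

Lemma perfect_subtree : perfect subtree.
Proof.
  split; [split|split].
  - intros s [Hs _]. exact Hs.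
  - intros s u ((_ & t & n & H) & Hs & Hsu). split; [exact Hs|]. exists t, n. auto.
  - destruct (node_seq 0 0 0 (le_n 0)) as (s & Hs & _). eauto.
  - intros s Hs. destruct (subtree_level s s Hs) as (t & n & Hn & H).
    destruct (HF _ (node_cle t n)) as (_ & _ & i & v & w & N & Hv & Hw).
    (* Changing digit [n] alone keeps the node of level [n] and selects either of its children,
       which disagree at [i]. *)
    set (t0 := Nat.clearbit t n). set (t1 := Nat.setbit t n).
    assert (E0 : node t0 n = node t n).
    { apply node_eq. intros j Hj. apply Nat.clearbit_neq. lia. }
    assert (E1 : node t1 n = node t n).
    { apply node_eq. intros j Hj. apply Nat.setbit_neq. lia. }
    assert (F0 : node t0 (S n) = F false (node t n)).
    { change (F (Nat.testbit t0 n) (node t0 n) = F false (node t n)).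
      rewrite E0. unfold t0. now rewrite Nat.clearbit_eq. }
    assert (F1 : node t1 (S n) = F true (node t n)).
    { change (F (Nat.testbit t1 n) (node t1 n) = F true (node t n)).
      rewrite E1. unfold t1. now rewrite Nat.setbit_eq. }
    (* Level [m] is past the split, and sequences of length [m] include the argument [i] and all
       indices of [s]. *)
    set (m := S n + S i + s).
    destruct (node_seq t0 m m (le_n m)) as (s0 & Hs0 & K0).
    destruct (node_seq t1 m m (le_n m)) as (s1 & Hs1 & K1).
    assert (C0 : cle (node t0 (S n)) (node t0 m)) by (apply node_mono; unfold m; lia).
    assert (C1 : cle (node t1 (S n)) (node t1 m)) by (apply node_mono; unfold m; lia).
    assert (D0 : cle (node t n) (node t0 m)).
    { rewrite <- E0. apply node_mono. unfold m. lia. }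
    assert (D1 : cle (node t n) (node t1 m)).
    { rewrite <- E1. apply node_mono. unfold m. lia. }
    exists s0, s1. split; [exact Hs0|]. split; [exact Hs1|]. split; [|split].
    + intros j a Ha. apply K0. destruct (entry_lt _ _ _ Ha). split; [unfold m; lia|].
      eapply Ph_mono; [exact D0|]. apply H, Ha.
    + intros j a Ha. apply K1. destruct (entry_lt _ _ _ Ha). split; [unfold m; lia|].
      eapply Ph_mono; [exact D1|]. apply H, Ha.
    + exists i, v, w. split; [|split; [|exact N]].
      * apply K0. split; [unfold m; lia|]. eapply Ph_mono; [exact C0|]. rewrite F0. exact Hv.
      * apply K1. split; [unfold m; lia|]. eapply Ph_mono; [exact C1|]. rewrite F1. exact Hw.
Qed.

(** All binary digits of 0 are false, so [node 0] always takes the first child. *)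
Definition leftmost (x : nat) : Prop := exists i v n, x = cpair i v /\ Ph (node 0 n) i v.

Lemma leftmost_pair i v : leftmost (cpair i v) <-> exists n, Ph (node 0 n) i v.
Proof.
  split.
  - intros (i' & v' & n & [-> ->]%cpair_inj & H). eauto.
  - intros (n & H). exists i, v, n. auto.
Qed.

Lemma leftmost_functional i v w n m : Ph (node 0 n) i v -> Ph (node 0 m) i w -> v = w.
Proof.
  intros Hv Hw. apply (Ph_functional (node 0 (n + m)) i); [apply node_cle| |].
  - eapply Ph_mono; [|exact Hv]. apply node_mono. lia.
  - eapply Ph_mono; [|exact Hw]. apply node_mono. lia.
Qed.

Lemma path_leftmost : path leftmost subtree.
Proof.
  split; [split; [|split]|].
  - intros x (i & v & n & E & _). eauto.
  - intros i. destruct (node_Ph 0 (S i) i ltac:(lia)) as (v & Hv).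
    exists v. apply leftmost_pair. eauto.
  - intros i v w [(n & Hv)%leftmost_pair (m & Hw)%leftmost_pair].
    apply (leftmost_functional i v w n m Hv Hw).
  - intros s [Hs H]. split; [exact Hs|]. exists 0, s. intros i v Hi.
    destruct (entry_lt _ _ _ Hi) as [Li _]. apply H, leftmost_pair in Hi as (n & Hv).
    destruct (node_Ph 0 s i Li) as (w & Hw).
    rewrite (leftmost_functional i v w n s Hv Hw). exact Hw.
Qed.

Lemma delta_leftmost : Delta Y leftmost.
Proof.
  pose proof sig_Ph as S1. pose proof sig_node as S2. split.
  - eapply ar_ext with (P := fun u => exists i v n, u 0 = cpair i v /\
      exists q t, t = 0 /\ q = node t n /\ Ph q i v); [|sig].
    intros u. unfold leftmost. split.
    + intros (i & v & n & E & q & t & -> & -> & H). eauto 6.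
    + intros (i & v & n & E & H). exists i, v, n. eauto 8.
  - eapply ar_ext with (P := fun u =>
      (forall i, i < S (u 0) -> forall v, v < S (u 0) -> u 0 <> cpair i v) \/
      exists i v w n, u 0 = cpair i v /\ v <> w /\
        exists q t, t = 0 /\ q = node t n /\ Ph q i w); [|sig].
    intros u. split.
    + intros [H|(i & v & w & n & E & N & q & t & -> & -> & H)].
      * intros (i & v & n & E & _). destruct (cpair_le i v).
        apply (H i ltac:(lia) v ltac:(lia) E).
      * rewrite E, leftmost_pair. intros (m & K). apply N, (leftmost_functional i v w m n K H).
    + intros H. destruct (classic (exists i v, u 0 = cpair i v)) as [(i & v & E)|N].
      * right. rewrite E in H. destruct (node_Ph 0 (S i) i ltac:(lia)) as (w & Hw).
        exists i, v, w, (S i). split; [exact E|]. split; [|eauto 6].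
        intros ->. apply H, leftmost_pair. eauto.
      * left. intros i _ v _ E. apply N. eauto.
Qed.

(* Any path of the tree agrees, to any length, with conditions extending one
   of the finitely many nodes of a given level, hence with extensions of a
   single one. *)
Lemma compatible_node X n : path X subtree -> exists t, forall l,
  exists q, cle (node t n) q /\ forall i v, i < l -> X (cpair i v) -> Ph q i v.
Proof.
  intros [(_ & Xtot & Xfun) HX]. apply NNPP. intros N.
  destruct (bounded_choice (2 ^ n) (fun t l => ~ exists q, cle (node t n) q /\
    forall i v, i < l -> X (cpair i v) -> Ph q i v)) as (l & Hl).
  - intros t a b Ha Hab (q & Hq & K). apply Ha. exists q. split; [exact Hq|].
    intros i v Hi. apply K. lia.
  - intros t _. apply NNPP. intros K. apply N. exists t. intros l. apply NNPP. eauto.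
  - set (f := fun i => proj1_sig (constructive_indefinite_description _ (Xtot i))).
    assert (Hf : forall i, X (cpair i (f i))).
    { intros i. unfold f. destruct (constructive_indefinite_description _ (Xtot i)). assumption. }
    clearbody f. destruct (seq_exists f l) as (s & Hs & E).
    assert (Ss : subtree s).
    { apply HX. split; [exact Hs|]. intros i v [_ ->]%E. apply Hf. }
    destruct (subtree_level s n Ss) as (t & m & Hm & K).
    assert (Ht : t mod 2 ^ n < 2 ^ n) by (apply Nat.mod_upper_bound, Nat.pow_nonzero; lia).
    apply (Hl _ Ht). exists (node t m). split.
    + rewrite node_mod. apply node_mono, Hm.
    + intros i v Hi Hv. apply K, E. split; [exact Hi|]. apply (Xfun i). auto.
Qed.

(** A node of level [S j] decides what [psi] computes at [j], and correctly, as [wrong] is excluded.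
    For a suitable node of that level, all forced bits are bits of [X]: the node has extensions
    agreeing with [X] to any length, and forced facts persist in these. *)
Lemma reduces_paths X : path X subtree -> reduces psi X Z.
Proof.
  intros HX j b Hb. destruct (compatible_node X (S j) HX) as (t & Ht).
  destruct (node_Ps t (S j) j ltac:(lia)) as (b' & Hb').
  assert (Hz : oset Z j b').
  { apply NNPP. intros N. apply (Hright (node t (S j))); [apply node_cle|].
    do 4 right. exists j, b'. auto. }
  rewrite (oset_functional Z j b b' Hb Hz).
  revert Hb'. apply ev_mono. intros x c Hc.
  destruct HX as [(Xpair & Xtot & Xfun) _].
  assert (Hc2 : c = 0 \/ c = 1).
  { apply NNPP. intros N. apply (Hright (node t (S j))); [apply node_cle|].
    left. exists x, c. tauto. }
  destruct Hc2 as [-> | ->].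
  (* If 0 were forced at an element of [X], an extension agreeing with [X] beyond [i] would force
     both 0 and 1 there. *)
  - right. split; [|reflexivity]. intros Hx. destruct (Xpair x Hx) as (i & v & ->).
    destruct (Ht (S i)) as (q & Hq & K). specialize (K i v ltac:(lia) Hx).
    apply (vname_mono _ _ _ _ Hq) in Hc.
    discriminate (ev_functional _ phi (jo_functional Y q) _ _ _ Hc K).
  - left. split; [|reflexivity].
    assert (Hp : exists i v, x = cpair i v).
    { apply NNPP. intros N. apply (Hright (node t (S j))); [apply node_cle|].
      right; left. exists x. split; [exact Hc|]. intros i v E. apply N. eauto. }
    destruct Hp as (i & v & ->). destruct (Xtot i) as (w & Hw).
    destruct (Ht (S i)) as (q & Hq & K). specialize (K i w ltac:(lia) Hw).
    apply (vname_mono _ _ _ _ Hq) in Hc.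
    rewrite (Ph_functional q i v w); [exact Hw| |exact Hc|exact K].
    eapply cle_trans; [apply node_cle|exact Hq].
Qed.

End Nodes.

Lemma forced_perfect_tree : exists S, Delta Y S /\ perfect S /\ (forall s, S s -> T s) /\
  (exists X, Delta Y X /\ path X S) /\ forall X, path X S -> reduces psi X Z.
Proof.
  destruct children_exist as (F & HF & SF). exists (subtree F).
  split; [apply delta_subtree; assumption|].
  split; [apply perfect_subtree; assumption|].
  split; [apply subtree_sub; assumption|].
  split; [|apply reduces_paths; assumption].
  exists (leftmost F). split; [apply delta_leftmost|apply path_leftmost]; assumption.
Qed.

End PerfectTree.

(** * Generic sets *)

(** For [k] up to 3, avoiding the set below a condition is a hypothesis of the section
    [PerfectTree]. Meeting it contradicts the properties of the path for [k < 3], and makes the path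
    computable from [Y] for [k = 3]. The last case makes [G] differ from the set that [phi] computes
    from [Y]. *)
Definition family Y phi psi (T Z : nat -> Prop) (k : nat) (q : nat) : Prop :=
  match k with
  | 0 => exists i, forall r, cle q r -> ~ exists v, pname Y phi r i v
  | 1 => exists j, forall r, cle q r -> ~ exists b, vfun Y phi psi r j b
  | 2 => wrong Y phi psi T Z q
  | 3 => ~ splits Y phi q
  | _ => exists i b b', cin q i b /\ ev (oset Y) phi i b' /\ b <> b'
  end.

Definition generic (Y G : nat -> Prop) : Prop :=
  forall phi psi T Z k, Delta Y T -> Delta Y Z -> decides G (family Y phi psi T Z k).

(** The sets [T] and [Z] computable from [Y] are given by programs, so the requirements can be
    numbered by codes; a number that codes no requirement yields the empty set of conditions. *)
Lemma generic_real_exists Y : exists G, generic Y G.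
Proof.
  destruct (generic_exists (fun n q => exists phi psi t z k,
    n = cpair (pcode phi) (cpair (pcode psi) (cpair (pcode t) (cpair (pcode z) k))) /\
    family Y phi psi (fun s => ev (oset Y) t s 1) (fun s => ev (oset Y) z s 1) k q))
    as (G & HG).
  exists G. intros phi psi T Z k HT HZ.
  apply reduces_of_delta in HT as (t & Ht), HZ as (z & Hz).
  assert (E : forall p X, reduces p Y X -> (fun s => ev (oset Y) p s 1) = X).
  { intros p X Hp. apply functional_extensionality. intros s. apply propositional_extensionality.
    rewrite (reduces_iff _ _ _ Hp). unfold oset. split; [intros [[]|[]]; (assumption || lia)|auto]. }
  destruct (HG (cpair (pcode phi) (cpair (pcode psi) (cpair (pcode t) (cpair (pcode z) k)))))
    as (q & Hq & H).
  exists q. split; [exact Hq|].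
  rewrite <- (E _ _ Ht), <- (E _ _ Hz). destruct H as [H|H]; [left|right].
  - destruct H as (phi' & psi' & t' & z' & k' & K & H).
    apply cpair_inj in K as [E1 K]. apply cpair_inj in K as [E2 K].
    apply cpair_inj in K as [E3 K]. apply cpair_inj in K as [E4 <-].
    apply pcode_inj in E1, E2, E3, E4. subst. exact H.
  - intros r Hr K. apply (H r Hr). exists phi, psi, t, z, k. auto.
Qed.

(** A disagreement cannot be avoided: any condition in [G] extends at a fresh position by the bit
    opposite to that of [G]. *)
Lemma generic_not_delta Y G : generic Y G -> ~ Delta Y G.
Proof.
  intros HG H. destruct (reduces_of_delta _ _ H) as (p & Hp).
  destruct (HG p p Y Y 4 (delta_refl Y) (delta_refl Y)) as (q & Hq & [(i & b & b' & K & L & N)|K]).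
  - apply N, (oset_functional G i); [apply Hq, K|]. apply (reduces_iff _ _ _ Hp), L.
  - destruct (cond_bit q) as (i & Hi).
    assert (Hb : exists b b', oset G i b' /\ b < 2 /\ b <> b').
    { destruct (classic (G i)); [exists 0, 1|exists 1, 0]; unfold oset; repeat split; auto. }
    destruct Hb as (b & b' & Hb' & Hb & N). destruct (Hi b Hb) as (r & Hr & L).
    apply (K r Hr). exists i, b, b'. split; [exact L|]. split; [apply Hp, Hb'|exact N].
Qed.

(** * The key step: a path computable from one generic extension *)

Section OneStep.
Variables (Y G T Z X : nat -> Prop) (phi psi : prog).
Hypothesis HG : generic Y G.
Hypothesis HT : Delta Y T.
Hypothesis HZ : Delta Y Z.
Hypothesis Hphi : reduces phi (join Y G) X.
Hypothesis Hpath : path X T.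
Hypothesis Hpsi : reduces psi X Z.

Lemma forced_name x b : oset X x b -> exists q, csub q G /\ vname Y phi q x b.
Proof.
  intros H. apply Hphi in H.
  apply (ev_cont (fun q => csub q G) (jo Y) phi).
  - destruct (cond_initial G 0) as (q & Hq & _). eauto.
  - intros q q' Hq Hq'. destruct (cond_directed G q q' Hq Hq') as (r & Hr & L & L').
    exists r. split; [exact Hr|]. split; apply jo_mono; assumption.
  - revert H. apply ev_mono. intros y c. apply join_jo.
Qed.

Lemma name_true q x b : csub q G -> vname Y phi q x b -> oset X x b.
Proof.
  intros Hq H. apply (reduces_iff _ _ _ Hphi). revert H. apply ev_mono, jo_join, Hq.
Qed.

Lemma forced_vfun j b : oset Z j b -> exists q, csub q G /\ vfun Y phi psi q j b.
Proof.
  intros H. apply Hpsi in H.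
  apply (ev_cont (fun q => csub q G) (vname Y phi) psi).
  - destruct (cond_initial G 0) as (q & Hq & _). eauto.
  - intros q q' Hq Hq'. destruct (cond_directed G q q' Hq Hq') as (r & Hr & L & L').
    exists r. split; [exact Hr|]. split; intros x c; apply vname_mono; assumption.
  - revert H. apply ev_mono. intros y c. apply forced_name.
Qed.

Lemma vfun_true q j b : csub q G -> vfun Y phi psi q j b -> oset Z j b.
Proof.
  intros Hq H. apply (reduces_iff _ _ _ Hpsi). revert H. apply ev_mono.
  intros x c. apply name_true, Hq.
Qed.

(** No condition in [G] can exclude all values at [i]: the path has a value there, some condition in
    [G] forces it, and any two conditions in [G] are compatible. *)
Lemma forced_total : exists p, csub p G /\
  forall q, cle p q -> forall i, exists r, cle q r /\ exists v, pname Y phi r i v.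
Proof.
  destruct (HG phi psi T Z 0 HT HZ) as (p & Hp & [(i & K)|K]).
  - destruct Hpath as [(_ & Xtot & _) _]. destruct (Xtot i) as (v & Hv).
    destruct (forced_name (cpair i v) 1) as (q & Hq & Hqv); [left; auto|].
    destruct (cond_directed G p q Hp Hq) as (r & Hr & L & L').
    destruct (K r L). exists v. unfold pname. eapply vname_mono; eassumption.
  - exists p. split; [exact Hp|]. intros q Hq i. apply NNPP. intros N.
    apply (K q Hq). exists i. intros r Hr Hv. apply N. eauto.
Qed.

Lemma forced_vfun_total : exists p, csub p G /\
  forall q, cle p q -> forall j, exists r, cle q r /\ exists b, vfun Y phi psi r j b.
Proof.
  destruct (HG phi psi T Z 1 HT HZ) as (p & Hp & [(j & K)|K]).
  - assert (Hb : exists b, oset Z j b).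
    { destruct (classic (Z j)); [exists 1; left|exists 0; right]; auto. }
    destruct Hb as (b & Hb). destruct (forced_vfun j b Hb) as (q & Hq & Hqb).
    destruct (cond_directed G p q Hp Hq) as (r & Hr & L & L').
    destruct (K r L). exists b. eapply Ps_mono; eassumption.
  - exists p. split; [exact Hp|]. intros q Hq j. apply NNPP. intros N.
    apply (K q Hq). exists j. intros r Hr Hv. apply N. eauto.
Qed.

Lemma forced_right : exists p, csub p G /\ forall q, cle p q -> ~ wrong Y phi psi T Z q.
Proof.
  destruct (HG phi psi T Z 2 HT HZ) as (p & Hp & [K|K]); [|eauto].
  destruct Hpath as [(Xpair & _ & Xfun) HX].
  assert (Ht : forall x, vname Y phi p x 1 -> X x).
  { intros x [[]|[]]%(name_true _ _ _ Hp); (assumption || lia). }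
  destruct K as [K|[K|[K|[K|K]]]]; exfalso.
  - destruct K as (x & b & [[]|[]]%(name_true _ _ _ Hp) & ? & ?); tauto.
  - destruct K as (x & Hx & N). destruct (Xpair x (Ht x Hx)) as (i & v & E). apply (N i v E).
  - destruct K as (i & v & w & N & Hv & Hw). apply N, (Xfun i). split; apply Ht; assumption.
  - destruct K as (s & Hs & H & N). apply N, HX. split; [exact Hs|]. intros i v Hi.
    apply Ht, H, Hi.
  - destruct K as (j & b & H & N). apply N, (vfun_true _ _ _ Hp H).
Qed.

(* If some condition in [G] has no splitting extensions, then all its extensions
   force the same values, which can be found by a search. *)
Lemma forced_splits : Delta Y X \/ exists p, csub p G /\ forall q, cle p q -> splits Y phi q.
Proof.
  destruct (HG phi psi T Z 3 HT HZ) as (p & Hp & [K|K]); [left|right].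
  - destruct Hpath as [(Xpair & Xtot & Xfun) _].
    assert (E : forall i v, X (cpair i v) <-> exists r, cle p r /\ pname Y phi r i v).
    { assert (E1 : forall i v, X (cpair i v) -> exists r, cle p r /\ pname Y phi r i v).
      { intros i v H. destruct (forced_name (cpair i v) 1) as (q & Hq & Hqv); [left; auto|].
        destruct (cond_directed G p q Hp Hq) as (r & Hr & L & L').
        exists r. split; [exact L|]. unfold pname. eapply vname_mono; eassumption. }
      intros i v. split; [apply E1|]. intros (r & Hr & Hv).
      destruct (Xtot i) as (w & Hw). destruct (E1 i w Hw) as (r' & Hr' & Hw').
      replace v with w; [exact Hw|]. apply NNPP. intros N. apply K.
      exists r, r', i, v, w. auto. }
    pose proof (sig_Ph Y phi) as S1. pose proof (sig_cle Y) as S2. split.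
    + eapply ar_ext with (P := fun u => exists i v, u 0 = cpair i v /\
        exists r, cle p r /\ pname Y phi r i v); [|sig].
      intros u. split.
      * intros (i & v & -> & H). apply E, H.
      * intros H. destruct (Xpair _ H) as (i & v & Eu). rewrite Eu in H. apply E in H. eauto.
    + eapply ar_ext with (P := fun u =>
        (forall i, i < S (u 0) -> forall v, v < S (u 0) -> u 0 <> cpair i v) \/
        exists i v w, u 0 = cpair i v /\ v <> w /\ exists r, cle p r /\ pname Y phi r i w); [|sig].
      intros u. split.
      * intros [N|(i & v & w & -> & N & H%E)] Hu.
        -- destruct (Xpair _ Hu) as (i & v & Eu). destruct (cpair_le i v).
           apply (N i ltac:(lia) v ltac:(lia) Eu).
        -- apply N, (Xfun i). auto.
      * intros Hu. destruct (classic (exists i v, u 0 = cpair i v)) as [(i & v & Eu)|N].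
        -- right. destruct (Xtot i) as (w & Hw). exists i, v, w. split; [exact Eu|].
           split; [intros ->; rewrite Eu in Hu; tauto|apply E, Hw].
        -- left. intros i _ v _ Eu. apply N. eauto.
  - exists p. split; [exact Hp|]. intros q Hq. apply NNPP, (K q Hq).
Qed.

Lemma path_below_generic : Delta Y X \/ exists S, Delta Y S /\ perfect S /\
  (forall s, S s -> T s) /\ (exists X', Delta Y X' /\ path X' S) /\
  forall X', path X' S -> reduces psi X' Z.
Proof.
  destruct forced_splits as [H|(p4 & H4 & K4)]; [left; exact H|right].
  destruct forced_total as (p1 & H1 & K1), forced_vfun_total as (p2 & H2 & K2),
    forced_right as (p3 & H3 & K3).
  destruct (cond_directed G p1 p2 H1 H2) as (p12 & H12 & L1 & L2).
  destruct (cond_directed G p3 p4 H3 H4) as (p34 & H34 & L3 & L4).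
  destruct (cond_directed G p12 p34 H12 H34) as (p & Hp & L12 & L34).
  apply (forced_perfect_tree Y phi psi T Z p); intros q Hq.
  - apply K1. eauto using cle_trans.
  - apply K2. eauto using cle_trans.
  - apply K3. eauto using cle_trans.
  - apply K4. eauto using cle_trans.
Qed.

End OneStep.

(** * The model *)

Definition gen (Y : nat -> Prop) : nat -> Prop :=
  proj1_sig (constructive_indefinite_description _ (generic_real_exists Y)).

Lemma gen_generic Y : generic Y (gen Y).
Proof. unfold gen. destruct (constructive_indefinite_description _ _). assumption. Qed.

Fixpoint stage (n : nat) : nat -> Prop :=
  match n with O => fun _ => False | S n => join (stage n) (gen (stage n)) end.

Definition model (X : nat -> Prop) : Prop := exists n, Delta (stage n) X.

Lemma stage_mono n m : n <= m -> Delta (stage m) (stage n).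
Proof.
  induction 1; [apply delta_refl|].
  eapply delta_trans; [apply delta_join_l|exact IHle].
Qed.

Lemma stage_strict n : ~ Delta (stage n) (stage (S n)).
Proof.
  intros H. apply (generic_not_delta _ _ (gen_generic (stage n))).
  eapply delta_trans; [exact H|apply delta_join_r].
Qed.

Lemma path_sub X S T : (forall s, S s -> T s) -> path X S -> path X T.
Proof. intros H [Hf HX]. split; [exact Hf|]. intros s Hs. apply H, HX, Hs. Qed.

(** Both alternatives of the key step lower the stage by one: the path is already computable there,
    or the perfect subtree has a path that is, on which the same [psi] still computes [Z]. *)
Lemma path_descent n m T Z X psi : n <= m -> Delta (stage n) T -> Delta (stage n) Z ->
  Delta (stage m) X -> path X T -> reduces psi X Z ->
  exists X', Delta (stage n) X' /\ path X' T /\ reduces psi X' Z.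
Proof.
  intros Hnm HT HZ. revert X. induction Hnm as [|m Hnm IH]; intros X HX Hpath Hpsi; [eauto|].
  pose proof (stage_mono _ _ Hnm) as Hm.
  destruct (reduces_of_delta _ _ HX) as (phi & Hphi).
  destruct (path_below_generic (stage m) (gen (stage m)) T Z X phi psi)
    as [H|(S & _ & _ & HS & (X' & HX' & HpX') & Hred)];
    try assumption; [apply gen_generic|eapply delta_trans; eassumption..| |].
  - apply (IH X); assumption.
  - apply (IH X'); [exact HX'|eapply path_sub; eassumption|apply Hred, HpX'].
Qed.

Lemma model_MPT : models model MPT.
Proof.
  intros v V _. apply sat_MPT. intros T (n & HT) [_ Hcof].
  destruct (Hcof (stage (S n))) as (X & (m & HX) & Hpath & Hle); [exists (S n); apply delta_refl|].
  apply turing_le_reduces in Hle as (psi & Hpsi).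
  assert (HX' : exists X, Delta (stage (S n)) X /\ path X T /\ reduces psi X (stage (S n))).
  { apply (path_descent (S n) (S n + m) T (stage (S n)) X psi); try assumption.
    - lia.
    - eapply delta_trans; [apply (stage_mono n); lia|exact HT].
    - apply delta_refl.
    - eapply delta_trans; [apply (stage_mono m); lia|exact HX]. }
  clear X m HX Hpath Hpsi. destruct HX' as (X & HX & Hpath & Hpsi).
  apply delta_of_reduces in Hpsi.
  (* The next use of the key step is over [stage n], so the set to be computed must be computable
     from [stage n]; [stage (S n)] no longer qualifies. *)
  assert (Hn : Delta X (stage n)) by (eapply delta_trans; [exact Hpsi|apply delta_join_l]).
  destruct (reduces_of_delta _ _ Hn) as (psi' & Hpsi').
  destruct (reduces_of_delta _ _ HX) as (phi & Hphi).
  destruct (path_below_generic (stage n) (gen (stage n)) T (stage n) X phi psi')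
    as [H|(S & HS & Hperf & Hsub & _ & Hred)];
    try assumption; [apply gen_generic|apply delta_refl| |].
  - destruct (stage_strict n). eapply delta_trans; eassumption.
  - exists S. split; [exists n; exact HS|]. split; [exact Hsub|]. split; [exact Hperf|].
    intros X' _ HX'. apply turing_le_delta.
    eapply delta_trans; [apply (delta_of_reduces _ _ _ (Hred X' HX'))|exact HS].
Qed.

(** * The axioms of RCA_0 in the model *)

Lemma sig_evalT t : Pol (fun v => evalT v t).
Proof.
  induction t; simpl; [apply pol_var|apply (pol_const 0)|apply (pol_const 1)|
    apply (pol_add _ _ IHt1 IHt2)|apply (pol_mul _ _ IHt1 IHt2)].
Qed.

(** The formula mentions finitely many set parameters, so one stage computes them all. Stating it
    for every later stage lets subformulas be combined. *)
Lemma delta0_sig M V p : Delta0 p -> (forall X, model (V X)) ->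
  exists n, forall m, n <= m ->
    Sig (stage m) (fun v => sat M v V p) /\ Sig (stage m) (fun v => ~ sat M v V p).
Proof.
  intros Hp HV. induction Hp; simpl.
  - exists 0. intros m _. pose proof (sig_evalT t). pose proof (sig_evalT u).
    split; [apply (ar_eq _ _ _ _ H H0)|apply (sig_use2 _ _ _ _ (sig_neq _) H H0)].
  - exists 0. intros m _. pose proof (sig_evalT t). pose proof (sig_evalT u).
    split; [apply (sig_use2 _ _ _ _ (sig_lt _) H H0)|apply (sig_use2 _ _ _ _ (sig_nlt _) H H0)].
  - destruct (HV X) as (n & HX). exists n. intros m Hm. pose proof (sig_evalT t) as Ht.
    destruct (delta_trans _ _ _ (stage_mono _ _ Hm) HX) as [H1 H0].
    split; [apply (sig_use1 _ _ _ H1 Ht)|apply (sig_use1 _ _ _ H0 Ht)].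
  - exists 0. intros m _. split.
    + apply ar_ext with (P := fun _ => 0 = 1); [intros v; split; [discriminate|tauto]|sig].
    + apply ar_ext with (P := fun _ => 0 = 0); [intros v; tauto|sig].
  - destruct IHHp1 as (n1 & K1), IHHp2 as (n2 & K2). exists (n1 + n2). intros m Hm.
    destruct (K1 m ltac:(lia)) as [P1 N1], (K2 m ltac:(lia)) as [P2 N2]. split.
    + eapply ar_ext; [|apply (ar_or _ _ _ _ N1 P2)]. intros v. simpl. tauto.
    + eapply ar_ext; [|apply (ar_and _ _ _ _ P1 N2)]. intros v. simpl. tauto.
  - destruct IHHp as (n & K). exists n. intros m Hm. destruct (K m Hm) as [P N].
    pose proof (sig_evalT t) as Ht.
    assert (E : forall a v, evalT (scons a v) (shiftT t) = evalT v t).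
    { intros a v. unfold shiftT. rewrite evalT_subst. reflexivity. }
    split.
    + eapply ar_ext; [|apply (ar_ball _ _ _ _ Ht P)].
      intros v. split; intros H a; specialize (H a); rewrite E in *; exact H.
    + eapply ar_ext; [|apply (ar_ex _ _ _ I (ar_and _ _ _ _ N
        (sig_use2 _ _ _ _ (sig_lt _) (pol_var 0) (pol_sh _ Ht))))].
      intros v. split.
      * intros (a & Ha & La) H. apply Ha, H. rewrite E. exact La.
      * intros H. apply NNPP. intros K'. apply H. intros a La. apply NNPP. intros Ha.
        apply K'. exists a. split; [exact Ha|]. rewrite E in La. exact La.
Qed.

Lemma sat_fAnd M v V p q : sat M v V (fAnd p q) <-> sat M v V p /\ sat M v V q.
Proof. simpl. tauto. Qed.

Lemma sat_fIff M v V p q : sat M v V (fIff p q) <-> (sat M v V p <-> sat M v V q).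
Proof. simpl. tauto. Qed.

Lemma sat_fExN M v V p : sat M v V (fExN p) <-> exists a, sat M (scons a v) V p.
Proof.
  simpl. split.
  - intros H. apply NNPP. intros N. apply H. intros a Ha. apply N. eauto.
  - intros (a & Ha) H. apply (H a Ha).
Qed.

Lemma model_RCA0 p : RCA0 p -> models model p.
Proof.
  intros [P HP|q _|q r [q0 Hq] [r0 Hr]] v V HV.
  - repeat (destruct HP as [<-|HP]); [..|destruct HP]; cbn; intros; try lia.
  (* The numbers of the model are standard, so this is induction in Rocq. *)
  - unfold induction_for. intros H%sat_fAnd. destruct H as [H0 HS].
    apply sat_instN in H0. intros a. induction a as [|a IH]; [exact H0|].
    specialize (HS a IH). rewrite sat_subst in HS. revert HS.
    match goal with |- sat _ ?f _ _ -> sat _ ?g _ _ => replace f with g; [exact (fun x => x)|] end.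
    apply functional_extensionality. intros [|n]; simpl; [lia|reflexivity].
  - unfold comprehension_for. intros E.
    assert (E' : forall a, sat model (scons a v) V (fExN q0) <-> sat model (scons a v) V (fAllN r0)).
    { intros a. apply sat_fIff, E. }
    clear E.
    destruct (delta0_sig model V q0 Hq HV) as (n & Kq), (delta0_sig model V r0 Hr HV) as (m & Kr).
    destruct (Kq (n + m) ltac:(lia)) as [Pq _], (Kr (n + m) ltac:(lia)) as [_ Nr].
    set (A := fun a => sat model (scons a v) V (fExN q0)).
    assert (HA : model A).
    (* The number parameters are substituted as constants, which leaves a relation in variable 0
       only. *)
    { set (s := fun i => match i with O => fun u : env => u 0 | S i => fun _ => v i end).
      assert (Hs : forall i, Pol (s i)) by (intros [|i]; [apply pol_var|apply (pol_const (v i))]).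
      assert (Es : forall u, (fun i => s i u) = scons (u 0) v)
        by (intros u; apply functional_extensionality; intros [|i]; reflexivity).
      exists (n + m). split.
      - eapply ar_ext; [|apply (ar_subst _ _ _ (ar_ex _ _ _ I Pq) s Hs)].
        intros u. unfold A. rewrite sat_fExN, Es. reflexivity.
      - eapply ar_ext; [|apply (ar_subst _ _ _ (ar_ex _ _ _ I Nr) s Hs)].
        intros u. unfold A. rewrite E', Es. simpl. split.
        + intros (b & Hb) H. apply Hb, H.
        + intros H. apply NNPP. intros N. apply H. intros b. apply NNPP. intros Hb.
          apply N. eauto. }
    intros H. apply (H A HA). intros a. apply sat_fIff. simpl sat at 1.
    rewrite sat_shiftS. reflexivity.
Qed.

(** * An infinite binary tree without paths in the model *)

Section Separation.
Let O := stage 0.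
(** The diagonal argument is [cpair e 1] because paths are sets of pairs: program [e], taken as a
    decision procedure for a path, is asked whether that path has value 1 at [e]. *)
Let A (e : nat) : Prop := value O e (cpair e 1) 1.
Let B (e : nat) : Prop := value O e (cpair e 1) 0.

(** A decidable tree can inspect an enumeration only up to a finite stage; [Q w e] is what stage [w]
    shows. *)
Lemma bounded_stages (R : nat -> Prop) : Sig1 O R -> exists Q : nat -> nat -> Prop,
  Sig2 O Q /\ Sig2 O (fun w e => ~ Q w e) /\ forall e, R e <-> exists w, Q w e.
Proof.
  intros HR. apply normal_form in HR as (Q & D & _ & E).
  exists (fun w e => Q (scons w (scons e (fun _ => 0)))).
  assert (Es : forall v, (fun i => args [fun v => v 0; fun v => v 1] i v)
    = scons (v 0) (scons (v 1) (fun _ => 0))).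
  { intros v. apply functional_extensionality. intros [|[|[|i]]]; reflexivity. }
  assert (Hs : forall i, Pol (args [fun v => v 0; fun v => v 1] i))
    by (apply args_pol; repeat constructor).
  split; [|split].
  - eapply ar_ext; [|apply (ar_subst _ _ _ (dl_sig _ _ D) _ Hs)].
    intros v. simpl. rewrite Es. reflexivity.
  - eapply ar_ext; [|apply (ar_subst _ _ _ (dl_sig _ _ (dl_not _ _ D)) _ Hs)].
    intros v. simpl. rewrite Es. reflexivity.
  - intros e. apply (E (scons e (fun _ => 0))).
Qed.

Lemma value_functional e x y y' : value O e x y -> value O e x y' -> y = y'.
Proof.
  intros (p & <- & H)%value_ev (q & Eq & H')%value_ev. apply pcode_inj in Eq as ->.
  apply (ev_functional _ _ (oset_functional O) _ _ _ H H').
Qed.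

(* The paths are the separating sets of two recursively inseparable sets. *)
Lemma kleene_tree : exists T, Delta O T /\ tree T /\
  (forall s i v, T s /\ entry s i v -> v < 2) /\
  ~ (exists k, forall n, T n -> n < k) /\
  forall X, Delta O X -> ~ path X T.
Proof.
  pose proof (sig_value _ _ (delta_refl O)) as Sv.
  destruct (bounded_stages A) as (QA & SA & NA & EA); [unfold A; sig|].
  destruct (bounded_stages B) as (QB & SB & NB & EB); [unfold B; sig|].
  (* The premise [entry s w u] confines the stage [w] to the domain of [s], so that [T] is decidable
     and closed under initial segments. *)
  set (T := fun s => isseq s /\ forall i v, entry s i v -> v < 2 /\
    forall w u, entry s w u -> (v = 1 -> ~ QA w i) /\ (v = 0 -> ~ QB w i)).
  exists T. split; [split|split; [split|split; [|split]]].
  - pose proof (sig_isseq O) as Ss.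
    eapply ar_ext with (P := fun x => isseq (x 0) /\ forall i, i < x 0 -> forall v, v < x 0 ->
      ~ entry (x 0) i v \/ (v < 2 /\ forall w, w < x 0 -> forall u, u < x 0 ->
        ~ entry (x 0) w u \/ ((v <> 1 \/ ~ QA w i) /\ (v <> 0 \/ ~ QB w i)))); [|sig].
    intros x. unfold T. split; intros [Hs H]; (split; [exact Hs|]).
    + intros i v Hv. destruct (entry_lt _ _ _ Hv) as [L1 L2].
      destruct (H i L1 v L2) as [|[Lv K]]; [tauto|]. split; [exact Lv|].
      intros w u Hu. destruct (entry_lt _ _ _ Hu) as [L3 L4].
      destruct (K w L3 u L4); tauto.
    + intros i _ v _. destruct (classic (entry (x 0) i v)) as [Hv|]; [right|auto].
      destruct (H i v Hv) as [Lv K]. split; [exact Lv|]. intros w _ u _.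
      destruct (classic (entry (x 0) w u)) as [Hu|]; [right|auto].
      specialize (K w u Hu). tauto.
  - pose proof (sig_nisseq O) as Ss.
    eapply ar_ext with (P := fun x => ~ isseq (x 0) \/ exists i v, entry (x 0) i v /\
      (2 <= v \/ exists w u, entry (x 0) w u /\ ((v = 1 /\ QA w i) \/ (v = 0 /\ QB w i)))); [|sig].
    intros x. unfold T. split.
    + intros [N|(i & v & Hv & K)] [Hs H]; [tauto|]. destruct (H i v Hv) as [Lv L].
      destruct K as [K|(w & u & Hu & K)]; [lia|]. specialize (L w u Hu). tauto.
    + intros N. apply NNPP. intros K. apply N. split; [apply NNPP; tauto|].
      intros i v Hv. split.
      * apply NNPP. intros L. apply K. right. exists i, v. split; [exact Hv|]. left. lia.
      * intros w u Hu. split; intros Ev HQ; apply K; right; exists i, v; (split; [exact Hv|]);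
          right; exists w, u; tauto.
  - intros s [Hs _]. exact Hs.
  - intros s t ([_ H] & Hs & Hst). split; [exact Hs|]. intros i v Hv.
    destruct (H i v (Hst i v Hv)) as [Lv K]. split; [exact Lv|].
    intros w u Hu. apply (K w u), Hst, Hu.
  - intros s i v [[_ H] Hv]. apply (H i v Hv).
  - intros (k & Hk).
    (* This [f] separates the disjoint sets [A] and [B], so its initial segments lie in [T]; the one
       of length [S k] has a code above [k]. *)
    set (f := fun i => if excluded_middle_informative (A i) then 0 else 1).
    destruct (seq_exists f (S k)) as (s & Hs & E).
    assert (Ts : T s).
    { split; [exact Hs|]. intros i v [_ ->]%E. unfold f.
      destruct (excluded_middle_informative (A i)) as [a|a]; (split; [lia|]); intros w _ _;
        (split; [intros Ev K|intros Ev K]); try discriminate Ev.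
      - assert (b : B i) by (apply EB; eauto). discriminate (value_functional _ _ _ _ a b).
      - apply a, EA. eauto. }
    apply Hk in Ts. assert (Hl : entry s k (f k)) by (apply E; split; [lia|reflexivity]).
    apply entry_lt in Hl. lia.
  - intros X HX [(_ & Xtot & Xfun) Hpath].
    destruct (reduces_of_delta _ _ HX) as (phi & Hphi). set (e := pcode phi).
    set (f := fun i => proj1_sig (constructive_indefinite_description _ (Xtot i))).
    assert (Hf : forall i, X (cpair i (f i))).
    { intros i. unfold f. destruct (constructive_indefinite_description _ (Xtot i)). assumption. }
    clearbody f.
    assert (K : forall w, f e < 2 /\ (f e = 1 -> ~ QA w e) /\ (f e = 0 -> ~ QB w e)).
    (* This length puts both the argument [e] and the stage [w] into the domain. *)
    { intros w. destruct (seq_exists f (S (e + w))) as (s & Hs & E).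
      assert (Ts : T s).
      { apply Hpath. split; [exact Hs|]. intros i v [_ ->]%E. apply Hf. }
      destruct Ts as [_ Ts]. destruct (Ts e (f e)) as [L M]; [apply E; split; [lia|reflexivity]|].
      split; [exact L|]. apply (M w (f w)), E. split; [lia|reflexivity]. }
    assert (Hcase : f e = 0 \/ f e = 1) by (destruct (K 0); lia).
    specialize (Hf e). destruct Hcase as [E|E]; rewrite E in *.
    + assert (b : B e).
      { apply ev_value, Hphi. right. split; [|reflexivity]. intros H1.
        discriminate (Xfun e 0 1 (conj Hf H1)). }
      apply EB in b as (w & Hw). destruct (K w) as (_ & _ & K0). apply K0; auto.
    + assert (a : A e) by (apply ev_value, Hphi; left; auto).
      apply EA in a as (w & Hw). destruct (K w) as (_ & K1 & _). apply K1; auto.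
Qed.

End Separation.

Theorem theorem3p2 : ~ implies_theory (extend RCA0 MPT) WKL0.
Proof.
  intros H.
  assert (HW : sat model (fun _ => 0) (fun _ => stage 0) WKL).
  { apply models_proves with (T := extend RCA0 MPT).
    - exists 0. apply delta_refl.
    - intros q [Hq| ->]; [apply model_RCA0, Hq|apply model_MPT].
    - apply H. right. reflexivity. }
  destruct kleene_tree as (T & HT & Htree & Hbin & Hinf & Hno).
  destruct (proj1 (sat_WKL model _ _) HW T) as (X & (n & HX) & Hpath);
    [exists 0; exact HT|auto|].
  (* Only a computable path is wanted, so [Z] is the empty set, which the constant program 0
     computes from any path. *)
  destruct (path_descent 0 n T (fun _ => False) X (PConst 0)) as (X' & HX' & Hpath' & _);
    try assumption.
  - lia.
  - apply delta_refl.
  - intros x b [[[]]|[_ Hb]]. exact Hb.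
  - apply (Hno X' HX' Hpath').
Qed.
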